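(* Consider the setting described in the context and fix $n\in\mathbb{N}$. Suppose that: 1. $A_n$ is closed and $f_n$ is lower semicontinuous relative to $A_n$. 2. The random elements $\boldsymbol{\xi}_1,\boldsymbol{\xi}_2,\dots$ are independent and identically distributed as $\boldsymbol{\xi}$. 3. (Continuity) For a.e. $\xi\in\Xi$ and $i=1,\dots,m$, the mappings $s(\xi,\cdot):Z\to U$, $g_i:U\times Z\to\mathbb{R}$ and $T_n$ are continuous; and for every $z_n\in\mathbb{R}^n$, $G_n(\cdot,z_n):\Xi\to\mathbb{R}^m$ is measurable. 4. (Local boundedness) For each $\bar z_n\in A_n$ there are $\rho\in(0,\infty)$ and a $P$-integrable $c:\Xi\to[0,\infty)$ such that $\|G_n(\xi,z_n)\|_\infty\le c(\xi)$ for all $z_n\in\mathbb{B}(\bar z_n,\rho)\cap A_n$ and a.e. $\xi\in\Xi$. 5. (Approximation of performance functions) There is a sequence $\{\epsilon^\nu\in[0,\infty),\nu\in\mathbb{N}\}$ with $\epsilon^\nu\to0$ such that $|g_i^\nu(u,z)-g_i(u,z)|\le\epsilon^\nu$ for all $u\in U$, $z\in Z^n\cap A$, $i=1,\dots,m$. 6. (Solution properties and approximations) There exist $\eta,\kappa\in(0,\infty)$, $\lambda,\mu:\Xi\to[0,\infty)$, $\rho,\pi:A_n\to(0,\infty)$ and $\Delta_0,\Delta_\nu:A_n\to[0,\infty)$, $\nu\in\mathbb{N}$, such that: (a) $\mathbb{E}[\lambda^\eta(\boldsymbol{\xi})\mu^\kappa(\boldsymbol{\xi})]$ and $\mathbb{E}[\mu^\kappa(\boldsymbol{\xi})]$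 are finite; (b) for all $z_n\in A_n$, $z^n=T_n(z_n)$, $u,u'\in U$, $\nu\in\mathbb{N}$, $i=1,\dots,m$, and a.e. $\xi\in\Xi$, one has $$|g_i(u,z^n)-g_i(u',z^n)|\le\pi(z_n)\big(\|u\|_U^\eta+\|u'\|_U^\eta+1\big)\|u-u'\|_U^\kappa,$$ $$\max\{\|s(\xi,z^n)\|_U,\|s^\nu(\xi,z^n)\|_U\}\le\lambda(\xi)\Delta_0(z_n),\qquad \|s^\nu(\xi,z^n)-s(\xi,z^n)\|_U\le\mu(\xi)\Delta_\nu(z_n);$$ (c) for all $\bar z_n\in A_n$, with $B=\mathbb{B}(\bar z_n,\rho(\bar z_n))\cap A_n$, one has $\sup_{z_n\in B}\pi(z_n)<\infty$, $\sup_{z_n\in B}\Delta_0(z_n)<\infty$, and $\sup_{z_n\in B}\Delta_\nu(z_n)\to0$ as $\nu\to\infty$. 7. $\liminf_\nu h^\nu(w^\nu)\ge h(w)>-\infty$ whenever $w^\nu\to w\in\mathbb{R}^m$. Then, with probability one (over the sample defining the functions $\phi_n^\nu$): if $\{\bar z_n^\nu\in\mathbb{R}^n,\ \nu\in\mathbb{N}\}$ converges to $\bar z_n$ along a subsequence indexed by an infinite set $N\subset\mathbb{N}$ as $\nu\to\infty$, then $$\phi\big(T_n(\bar z_n)\big)\le\liminf_{\nu\in N}\phi_n^\nu(\bar z_n^\nu).$$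
   Context: Setting. $(Z,\|\cdot\|_Z)$ and $(U,\|\cdot\|_U)$ are separable Banach spaces; product spaces carry the product norm. $\boldsymbol{\xi}$ is a measurable function from a probability space $(\Omega,\mathcal{F},\mathbb{P})$ to a Hilbert space $\Xi$ (of functions on a domain $D\subset\mathbb{R}^d$) with Borel $\sigma$-field, inducing the probability space $(\Xi,\mathcal{B},P)$, which is taken to be complete; ''a.e. $\xi$'' refers to $P$. $A\subset Z$ is the admissible set; $f:Z\to\mathbb{R}$; $h:\mathbb{R}^m\to\overline{\mathbb{R}}=[-\infty,\infty]$; $s:\Xi\times Z\to U$ (solution mapping); $g_i:U\times Z\to\mathbb{R}$, $i=1,\dots,m$; $G:\Xi\times Z\to\mathbb{R}^m$, $G(\xi,z)=(g_1(s(\xi,z),z),\dots,g_m(s(\xi,z),z))$. The actual objective function is $$\phi(z)=\iota_A(z)+f(z)+h\big(\mathbb{E}[G(\boldsymbol{\xi},z)]\big),\quad z\in Z,$$ where $\iota_C$ is $0$ on $C$ and $\infty$ off $C$, $\mathbb{E}[G(\boldsymbol{\xi},z)]=\int G(\xi,z)\,dP(\xi)$ is assumed well defined and finite, extended arithmetic has $\infty-\infty=\infty$, and $\phi(z)=\infty$ if $z\notin A$. Discretization. For each $n\in\mathbb{N}$, $Z^n\subset Z$ and $T_n:\mathbb{R}^n\to Z^n$ is surjective. $A_n=\{z_n\in\mathbb{R}^n\mid T_n(z_n)\in A\}$, $f_n(z_n)=f(T_n(z_n))$, $G_n(\xi,z_n)=G(\xi,T_n(z_n))$, $\phi_n(z_n)=\phi(T_n(z_n))$.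 Approximation. For $\nu\in\mathbb{N}$: $h^\nu:\mathbb{R}^m\to\overline{\mathbb{R}}$, $g_i^\nu:U\times Z\to\mathbb{R}$, $s^\nu:\Xi\times Z\to U$ are given functions, $G^\nu(\xi,z)=(g_1^\nu(s^\nu(\xi,z),z),\dots,g_m^\nu(s^\nu(\xi,z),z))$, $G_n^\nu(\xi,z_n)=G^\nu(\xi,T_n(z_n))$. For a realization $\xi_1,\xi_2,\dots$ of the sample $\boldsymbol{\xi}_1,\boldsymbol{\xi}_2,\dots$, $$\phi_n^\nu(z_n)=\iota_{A_n}(z_n)+f_n(z_n)+h^\nu\Big(\frac1\nu\sum_{j=1}^\nu G_n^\nu(\xi_j,z_n)\Big),\quad z_n\in\mathbb{R}^n.$$ $\mathbb{B}(\bar z_n,\rho)=\{z_n\in\mathbb{R}^n\mid\|z_n-\bar z_n\|_2\le\rho\}$. A function $g$ is lower semicontinuous relative to $C$ if $\liminf g(x^\nu)\ge g(x)$ whenever $x^\nu\in C$ converges to $x\in C$. *)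

(* Defs.v *)
From HB Require Import structures.
From mathcomp Require Import all_boot all_order all_algebra finmap.
From mathcomp Require Import all_classical all_reals all_analysis.
From mathcomp Require Import measurable_realfun.

Set Implicit Arguments.
Unset Strict Implicit.
Unset Printing Implicit Defensive.

Import Order.TTheory GRing.Theory Num.Theory.
Import numFieldNormedType.Exports.

Local Open Scope classical_set_scope.
Local Open Scope ring_scope.

Definition separable (X : topologicalType) : Prop :=
  exists2 D : set X, countable D & dense D.

(* The norm of the Banach space X comes from an inner product. *)
Definition hilbertian (R : realType) (X : completeNormedModType R) : Prop :=
  exists ip : X -> X -> R,
    [/\ forall x y, ip x y = ip y x,
        forall a x y z, ip (a *: x + y) z = a * ip x z + ip y z
      & forall x, ip x x = `|x| ^+ 2].

Notation borel X := (g_sigma_algebraType (@open X)).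

Section completed_law.
Context d d' (Om : measurableType d) (V : measurableType d') (R : realType)
  (Pr : probability Om R) (X : {RV Pr >-> V}).
Local Open Scope ereal_scope.
Local Notation law := (distribution Pr X).

(* The completion of the law of X; it lives on the completion of the
   sigma-field of V under this law (see completed_law_measurable). *)
Definition completed_law := @completed_measure_extension _ _ _ law.

HB.instance Definition _ := Measure.on completed_law.

Lemma completed_lawE (A : set V) : measurable A -> completed_law A = law A.
Proof. by move=> mA; exact: measurable_mu_extE. Qed.

Let completed_law_setT : completed_law setT = 1%:E.
Proof. by rewrite completed_lawE// probability_setT. Qed.

HB.instance Definition _ := Measure_isProbability.Build _ _ _
  completed_law completed_law_setT.

Lemma completed_law_complete : measure_is_complete completed_law.
Proof. exact: measure_is_complete_caratheodory. Qed.

Lemma completed_law_hull (A : set V) :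
  exists2 B : set V, measurable B & A `<=` B /\ law B = completed_law A.
Proof.
have fA : completed_law A \is a fin_num.
  rewrite ge0_fin_numE ?mu_ext_ge0// (@le_lt_trans _ _ (completed_law setT))//.
    by apply: le_mu_ext.
  by rewrite completed_law_setT ltry.
have cov n : exists B : set V, [/\ measurable B, A `<=` B
    & law B <= completed_law A + n.+1%:R^-1%:E].
  have n0 : (0 < n.+1%:R^-1 :> R)%R by rewrite invr_gt0.
  have := lb_ereal_inf_adherent n0 fA.
  move=> [_ [F [mF AF] <-] lF].
  exists (\bigcup_k F k); split => //; first exact: bigcupT_measurable.
  apply: (le_trans _ (ltW lF)).
  by apply: measure_sigma_subadditive => //; exact: bigcupT_measurable.
pose B n := projT1 (cid (cov n)).
have BP n : [/\ measurable (B n), A `<=` B n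
    & law (B n) <= completed_law A + n.+1%:R^-1%:E].
  by rewrite /B; case: cid.
have mB : measurable (\bigcap_n B n).
  by apply: bigcapT_measurable => n; case: (BP n).
have AB : A `<=` \bigcap_n B n by apply: sub_bigcap => n _; case: (BP n).
exists (\bigcap_n B n) => //; split=> //.
apply/eqP; rewrite eq_le; apply/andP; split; last first.
  by rewrite -completed_lawE//; apply: le_mu_ext.
apply/lee_addgt0Pr => _/posnumP[e]; near \oo => n.
have [mBn _ lBn] := BP n.
apply: (@le_trans _ _ (law (B n))).
  by apply: le_measure; rewrite ?inE//; exact: bigcap_inf.
rewrite (le_trans lBn)// leeD// lee_fin ltW//.
by near: n; apply: near_infty_natSinv_lt.
Unshelve. all: by end_near. Qed.

Lemma completed_law_measurable :
  (law^*)%mu.-cara.-measurable = completed_algebra_gen law.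
Proof.
have sub (A : set V) : measurable A -> (law^*)%mu.-cara.-measurable A.
  by move=> mA; exact: caratheodory_measurable_mu_ext.
apply/seteqP; split=> [A mA|_ [B mB [N [C [mC C0 NC]] <-]]]; last first.
  apply: measurableU; first exact: sub.
  apply: completed_law_complete; exists C; split=> //; first exact: sub.
  by rewrite completed_lawE.
have [B mB [AB lB]] := completed_law_hull A.
have [C mC [AC lC]] := completed_law_hull (~` A).
have CB : ~` C `<=` B by move=> x Cx; apply: AB; apply: contrapT => /AC.
exists (~` C); first exact: measurableC.
exists (A `&` C); last first.
  apply/seteqP; split=> [x [Cx|[]//]|x Ax].
    by apply: contrapT => /AC.
  by have [Cx|Cx] := pselect (C x); [right|left].
exists (B `&` C); split; [exact: measurableI| |exact: setSI].
have -> : B `&` C = B `\` ~` C by rewrite setDE setCK.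
rewrite measureD//; last 2 first.
- exact: measurableC.
- by rewrite (le_lt_trans (probability_le1 _ _))// ltry.
rewrite setIidr//; change (law B - law (~` C) = 0).
have -> : law (~` C) = 1 - law C by exact: probability_setC.
rewrite lB lC (_ : completed_law (~` A) = 1 - completed_law A); last first.
  exact: (@probability_setC _ _ _ completed_law).
have fA : completed_law A \is a fin_num by exact: fin_num_measure.
by rewrite -(fineK fA) -!EFinB subKr subrr.
Qed.
End completed_law.
Arguments completed_law {d d' Om V R} Pr X.
Notation completed Pr X := (caratheodory_type (distribution Pr X)^*%mu).

Definition mutually_independent d d' (Om : measurableType d)
    (V : measurableType d') (R : realType) (Pr : probability Om R)
    (X : nat -> {RV Pr >-> V}) : Prop :=
  forall (J : {fset nat}) (B : nat -> set V),
    (forall j, j \in J -> measurable (B j)) ->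
    Pr (\bigcap_(j in [set` J]) (X j @^-1` B j)) =
    (\prod_(j <- J) Pr (X j @^-1` B j))%E.

Definition identically_distributed d d' (Om : measurableType d)
    (V : measurableType d') (R : realType) (Pr : probability Om R)
    (X : nat -> {RV Pr >-> V}) (Y : {RV Pr >-> V}) : Prop :=
  forall j (B : set V), measurable B ->
    distribution Pr (X j) B = distribution Pr Y B.

Definition indicator (R : realType) (X : Type) (A : set X) (x : X) : \bar R :=
  if `[< A x >] then 0%E else +oo%E.

Definition lsc_relative (R : realType) (X : topologicalType) (C : set X)
    (g : X -> R) : Prop :=
  forall (u : nat -> X) (x : X), (forall k, C (u k)) -> C x ->
    u @ \oo --> x -> ((g x)%:E <= limn_einf (fun k => (g (u k))%:E))%E.

Definition ball2 (R : realType) (n : nat) (x : 'rV[R]_n) (r : R)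
    : set 'rV[R]_n :=
  [set y | Num.sqrt (\sum_(i < n) (y ord0 i - x ord0 i) ^+ 2) <= r].

(* iota_A + f + h o w; the addition of %dE has +oo + -oo = +oo. *)
Definition objective (R : realType) (X : Type) (m : nat) (A : set X)
    (f : X -> R) (h : 'rV[R]_m -> \bar R) (w : X -> 'rV[R]_m) (x : X)
    : \bar R :=
  (indicator R A x + (f x)%:E + h (w x))%dE.

Section performance.
Context (R : realType) (Z U : completeNormedModType R) (Xi : Type) (m : nat).

Definition perf (g : 'I_m -> U * Z -> R) (s : Xi -> Z -> U) (xi : Xi) (z : Z)
    : 'rV[R]_m :=
  \row_i g i (s xi z, z).

Definition mean_perf dXi (V : measurableType dXi) (P : {measure set V -> \bar R})
    (g : 'I_m -> U * Z -> R) (s : V -> Z -> U) (z : Z) : 'rV[R]_m :=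
  \row_i \int[P]_x g i (s x z, z).

(* The sample xi_1, xi_2, ... is indexed from 0: x j is xi_(j+1). *)
Definition sample_mean (g : 'I_m -> U * Z -> R) (s : Xi -> Z -> U)
    (x : nat -> Xi) (nu : nat) (z : Z) : 'rV[R]_m :=
  nu%:R^-1 *: \sum_(j < nu) perf g s (x j) z.
End performance.

(* Main.v *)
From HB Require Import structures.
Require Import Defs.
From mathcomp Require Import all_boot all_order all_algebra finmap.
From mathcomp Require Import all_classical all_reals all_analysis.
From mathcomp Require Import measurable_realfun lra ring.

Import Order.TTheory GRing.Theory Num.Theory.
Import numFieldNormedType.Exports.
Local Open Scope classical_set_scope.
Local Open Scope ring_scope.

(** The value of the limit objective at a limit point outside the admissible
set is harmless: this set is closed, so the approximating objectives are
eventually +oo as well.  At an admissible limit point zbar, everything follows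
from the convergence of the sample means: almost surely, for all admissible
u nu --> zbar, the mean over j < nu of G^nu (xi_j, u nu) tends to
E [G (xi, zbar)].  Lower semicontinuity of f and the assumption on the h^nu then
add up, since h > -oo at the limit rules out any cancellation of infinities
(objective_liminf).

The convergence of the sample means has two parts.  Replacing g^nu and s^nu by
g and s changes the mean by at most
eps nu + Pi (2 D^eta mean (lambda^eta mu^kappa) + mean (mu^kappa)) delta nu^kappa
with eps nu and delta nu tending to 0, and both means are bounded by the strong
law of large numbers (approximation_error_cvg0).  What remains is a strong law
for G at moving points (uniform_strong_law): the oscillation of G (x, _) over a
small ball is dominated and tends to 0 with the radius, so its expectation is
small, and the strong law bounds the error made by replacing the moving point by
the centre of a fixed ball.  Null sets may be discarded for countably many balls
only; balls centred at a dense sequence of the admissible set are enough.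

The strong law itself (strong_law) is proved by Etemadi's method.  For a
nonnegative integrable f and blocks of length k n of order a^n, the variables of
the n-th block are truncated at k n.  Both the mean square deviations of the
truncated block means and the expected numbers of variables affected by the
truncation are summable, with sums at most a multiple of the expectation of f;
hence the block means converge almost surely (lln_geom_block).  Means of
nonnegative numbers vary little between two blocks when a is close to 1
(cvg_mean_geom_block).

Finally, the integrands are measurable for the completion of the law of xi only,
while the sample is Borel measurable.  Such an integrand agrees with a Borel
function off a Borel null set (completed_law_borel_version), which almost surely
no sample point meets, so the strong law extends to it
(strong_law_completed). *)

Set Implicit Arguments.
Unset Strict Implicit.
Unset Printing Implicit Defensive.

(** * Pairwise independent random elements *)

(** Weaker than mutual independence, and all that a variance computation uses. *)
Definition pairwise_independent d d' (Om : measurableType d)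
    (V : measurableType d') (R : realType) (Pr : probability Om R)
    (X : nat -> {RV Pr >-> V}) : Prop :=
  forall i j, i <> j -> forall B C : set V, measurable B -> measurable C ->
    Pr (X i @^-1` B `&` X j @^-1` C) = (Pr (X i @^-1` B) * Pr (X j @^-1` C))%E.

Lemma mutually_pairwise_independent d d' (Om : measurableType d)
    (V : measurableType d') (R : realType) (Pr : probability Om R)
    (X : nat -> {RV Pr >-> V}) :
  mutually_independent X -> pairwise_independent X.
Proof.
move=> ind i j /eqP ij B C mB mC.
have ji : (j == i) = false by apply/negbTE; rewrite eq_sym.
pose F k := if k == i then B else C.
have mF k : k \in [fset i; j]%fset -> measurable (F k).
  by move=> _; rewrite /F; case: ifP.
have := ind [fset i; j]%fset F mF.
have -> : \bigcap_(k in [set` [fset i; j]%fset]) (X k @^-1` F k) =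
          X i @^-1` B `&` X j @^-1` C.
  apply/seteqP; split=> [w h|w [hB hC] k /=].
    split; [have := h i|have := h j]; rewrite /= !inE eqxx ?orbT /F ?eqxx ?ji;
    exact.
  by rewrite !inE /F => /orP[|] /eqP ->; rewrite ?eqxx ?ji.
by move=> ->; rewrite big_fsetU1 ?inE//= big_seq_fset1 /F eqxx ji.
Qed.

(** The joint law of X and Y agrees with the product of their laws on rectangles,
hence on all measurable sets, and Tonelli's theorem applies. *)
Lemma integralM_indep d d' (Om : measurableType d)
    (V : measurableType d') (R : realType) (Pr : probability Om R)
    (X Y : {RV Pr >-> V}) (F G : V -> \bar R) :
  (forall B C : set V, measurable B -> measurable C ->
    Pr (X @^-1` B `&` Y @^-1` C) = (Pr (X @^-1` B) * Pr (Y @^-1` C))%E) ->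
  measurable_fun setT F -> measurable_fun setT G ->
  (forall v, 0 <= F v)%E -> (forall v, 0 <= G v)%E ->
  (\int[Pr]_w (F (X w) * G (Y w)) =
   (\int[distribution Pr X]_v F v) * (\int[distribution Pr Y]_v G v))%E.
Proof.
move=> ind mF mG F0 G0.
have mXY : measurable_fun setT (fun w => (X w, Y w)).
  exact: measurable_fun_pair.
pose Z : {RV Pr >-> (V * V)%type} :=
  HB.pack (fun w => (X w, Y w)) (isMeasurableFun.Build _ _ _ _ _ mXY).
pose H (z : V * V) := (F z.1 * G z.2)%E.
have mH : measurable_fun setT H.
  by apply: emeasurable_funM; apply: measurableT_comp.
have H0 z : (0 <= H z)%E by rewrite mule_ge0.
have -> : (\int[Pr]_w (F (X w) * G (Y w)) = \int[Pr]_w (H \o Z) w)%E by [].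
rewrite -ge0_integral_distribution//.
have -> : (\int[distribution Pr Z]_z H z =
   \int[(distribution Pr X \x distribution Pr Y)%E]_z H z)%E.
  apply: eq_measure_integral => A mA _; apply/esym.
  apply: (product_measure_unique (m' := distribution Pr Z)) => //.
rewrite fubini_tonelli1//.
under eq_integral do rewrite /fubini_F /H /= ge0_integralZl//.
by rewrite ge0_integralZr// integral_ge0.
Qed.

(** * Series of integrals *)

Lemma near_cvg_seq (T : topologicalType) (u v : nat -> T) (l : T) :
  (\forall n \near \oo, u n = v n) -> u @ \oo --> l -> v @ \oo --> l.
Proof. by move=> /near_eq_cvg; apply: cvg_trans. Qed.

Lemma nneseries_cvg0 (R : realType) (f : nat -> \bar R) :
  (forall n, 0 <= f n)%E -> (\sum_(n <oo) f n < +oo)%E -> f @ \oo --> 0%E.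
Proof.
move=> f0 foo.
have := nneseries_tail_cvg foo (fun k _ => f0 k).
apply: (@squeeze_cvge _ _ _ _ (cst 0%E)); last exact: cvg_cst.
apply: nearW => n; rewrite f0/=.
have h := @nneseries_lim_ge R f xpredT n n.+1 (fun i _ _ => f0 i).
apply: le_trans h; by rewrite big_nat1.
Qed.

(** The Borel-Cantelli argument with functions in place of sets: the sum of the
D n has a finite integral, so it is finite almost everywhere, and the terms of a
convergent series tend to 0. *)
Lemma ae_cvg0_nneseries d (Om : measurableType d) (R : realType)
    (mu : {measure set Om -> \bar R}) (D : nat -> Om -> R) :
  (forall n, measurable_fun setT (D n)) -> (forall n w, 0 <= D n w) ->
  (\sum_(n <oo) \int[mu]_w (D n w)%:E < +oo)%E ->
  {ae mu, forall w, (fun n => D n w) @ \oo --> 0}.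
Proof.
move=> mD D0 Doo.
have mD' n : measurable_fun setT (fun w => (D n w)%:E).
  exact/measurable_EFinP.
pose S w := (\sum_(n <oo) (D n w)%:E)%E.
have S0 w : (0 <= S w)%E.
  by apply: nneseries_ge0 => n _ _; rewrite lee_fin.
have iS : mu.-integrable setT S.
  apply/integrableP; split.
    apply: ge0_emeasurable_sum => // n w _ _; by rewrite lee_fin.
  under eq_integral do rewrite gee0_abs//.
  rewrite /S integral_nneseries// => n w _; by rewrite lee_fin.
have := integrable_ae measurableT iS.
apply: filterS => w /(_ I) Sfin.
have /fine_cvgP[_ ] : (fun n => (D n w)%:E) @ \oo --> 0%E.
  apply: nneseries_cvg0 => [n|]; first by rewrite lee_fin.
  by rewrite -ge0_fin_numE// S0.
exact.
Qed.

(** * The strong law of large numbers *)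

Lemma ge0_integral_identically_distributed d d' (Om : measurableType d)
    (V : measurableType d') (R : realType) (Pr : probability Om R)
    (X : nat -> {RV Pr >-> V}) (Y : {RV Pr >-> V}) (H : V -> \bar R) i :
  identically_distributed X Y ->
  measurable_fun setT H -> (forall v, 0 <= H v)%E ->
  (\int[Pr]_w H (X i w) = \int[distribution Pr Y]_v H v)%E.
Proof.
move=> idd mH H0.
transitivity (\int[distribution Pr (X i)]_v H v)%E.
  by rewrite ge0_integral_distribution.
by apply: eq_measure_integral => B mB _; exact: idd.
Qed.

(** The variance of a mean of k.+1 uncorrelated variables is the variance of one of
them over k.+1, and the variance is at most the second moment.  Since F is
nonnegative, all the integrals can be computed in [0, +oo], without checking
integrability. *)
Lemma mean_square_deviation_le d d' (Om : measurableType d)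
    (V : measurableType d') (R : realType) (Pr : probability Om R)
    (X : nat -> {RV Pr >-> V}) (Y : {RV Pr >-> V}) (F : V -> R) (m : R) k :
  pairwise_independent X -> identically_distributed X Y ->
  measurable_fun setT F -> (forall v, 0 <= F v) ->
  (\int[distribution Pr Y]_v (F v)%:E = m%:E)%E ->
  (\int[Pr]_w ((k.+1%:R^-1 * (\sum_(i < k.+1) F (X i w)) - m) ^+ 2)%:E <=
   k.+1%:R^-1%:E * \int[distribution Pr Y]_v (F v ^+ 2)%:E)%E.
Proof.
move=> ind idd mF F0 Fm.
set q : R := k.+1%:R^-1.
have q0 : 0 <= q by rewrite invr_ge0.
set M2 := (\int[distribution Pr Y]_v (F v ^+ 2)%:E)%E.
have M20 : (0 <= M2)%E by apply: integral_ge0 => v _; rewrite lee_fin sqr_ge0.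
have m0 : 0 <= m.
  by rewrite -lee_fin -Fm; apply: integral_ge0 => v _; rewrite lee_fin.
pose S w := \sum_(i < k.+1) F (X i w).
have mFX i : measurable_fun setT (fun w => F (X i w)).
  exact: measurableT_comp.
have mS : measurable_fun setT S by apply: measurable_sum.
have S0 w : 0 <= S w by apply: sumr_ge0.
have ES : (\int[Pr]_w (S w)%:E = (k.+1%:R * m)%:E)%E.
  under eq_integral do rewrite /S -sumEFin.
  rewrite ge0_integral_sum//; last 2 first.
  - by move=> i; apply/measurable_EFinP.
  - by move=> i w _; rewrite lee_fin.
  rewrite (eq_bigr (fun=> m%:E)) => [|i _].
    by rewrite sumEFin sumr_const card_ord mulr_natl.
  rewrite (@ge0_integral_identically_distributed _ _ _ _ _ _ X Y
    (fun v => (F v)%:E))//; exact/measurable_EFinP.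
have ES2 : (\int[Pr]_w (S w ^+ 2)%:E <=
    (k.+1%:R ^+ 2 * m ^+ 2)%:E + k.+1%:R%:E * M2)%E.
  under eq_integral do rewrite /S expr2 big_distrlr/= -sumEFin.
  rewrite ge0_integral_sum//; last 2 first.
  - move=> i; apply/measurable_EFinP; apply: measurable_sum => j.
    exact: measurable_funM.
  - by move=> i w _; rewrite lee_fin sumr_ge0// => j _; rewrite mulr_ge0.
  have Eij (i j : 'I_k.+1) : (\int[Pr]_w (F (X i w) * F (X j w))%:E <=
      (m ^+ 2)%:E + (i == j)%:R%:E * M2)%E.
    have [<-{j}|ij] := eqVneq i j.
      rewrite mul1e (_ : (\int[Pr]_w _)%E = M2).
        by rewrite leeDr// lee_fin sqr_ge0.
      under eq_integral do rewrite -expr2.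
      apply: (@ge0_integral_identically_distributed _ _ _ _ _ _ X Y
        (fun v => (F v ^+ 2)%:E)) => //.
        by apply/measurable_EFinP; exact: measurable_funX.
      by move=> v; rewrite lee_fin sqr_ge0.
    rewrite mul0e adde0.
    have mF' : measurable_fun setT (fun v => (F v)%:E) by apply/measurable_EFinP.
    have F0' v : (0 <= (F v)%:E)%E by rewrite lee_fin.
    under eq_integral do rewrite EFinM.
    rewrite (@integralM_indep _ _ _ _ _ _ (X i) (X j) (fun v => (F v)%:E)
      (fun v => (F v)%:E))//; last first.
      by apply: ind => e; move/eqP: ij; apply; apply/val_inj.
    have E l : (\int[distribution Pr (X l)]_v (F v)%:E = m%:E)%E.
      rewrite -Fm; apply: eq_measure_integral => B mB _; exact: idd.
    by rewrite !E -EFinM expr2.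
  have -> : ((k.+1%:R ^+ 2 * m ^+ 2)%:E + k.+1%:R%:E * M2 =
     \sum_(i < k.+1) \sum_(j < k.+1) ((m ^+ 2)%:E + (i == j)%:R%:E * M2))%E.
    under eq_bigr => i _.
      rewrite big_split/= sumEFin sumr_const card_ord -ge0_sume_distrl; last first.
        by move=> j _; rewrite lee_fin.
      rewrite sumEFin (bigD1 i)//= eqxx big1 => [|j /negbTE]; last first.
        by rewrite eq_sym => ->.
      rewrite addr0 mul1e.
      over.
    rewrite big_split/= sumEFin sumr_const card_ord; congr (_ + _)%E.
      by congr (_%:E); rewrite expr2 -mulrA !mulr_natl.
    under eq_bigr do rewrite -[M2]mul1e.
    rewrite -ge0_sume_distrl; last by move=> i _; rewrite lee_fin.
    by rewrite sumEFin sumr_const card_ord.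
  apply: lee_sum => i _.
  under eq_integral do rewrite -sumEFin.
  rewrite ge0_integral_sum//; last 2 first.
  - by move=> j; apply/measurable_EFinP; exact: measurable_funM.
  - by move=> j w _; rewrite lee_fin mulr_ge0.
  by apply: lee_sum => j _; exact: Eij.
pose D w := (q * S w - m) ^+ 2.
have mD : measurable_fun setT D.
  apply: measurable_funX; apply: measurable_funB => //.
  exact: measurable_funM.
(* the binomial formula, arranged so that all terms are nonnegative *)
have key : (\int[Pr]_w (D w)%:E + (2 * m * q)%:E * \int[Pr]_w (S w)%:E =
    (q ^+ 2)%:E * \int[Pr]_w (S w ^+ 2)%:E + (m ^+ 2)%:E)%E.
  rewrite -ge0_integralZl//; first last.
  - by rewrite lee_fin !mulr_ge0.
  - by move=> w _; rewrite lee_fin.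
  - exact/measurable_EFinP.
  rewrite -ge0_integralZl//; first last.
  - by rewrite lee_fin sqr_ge0.
  - by move=> w _; rewrite lee_fin sqr_ge0.
  - by apply/measurable_EFinP; exact: measurable_funX.
  rewrite -ge0_integralD//; first last.
  - by apply: measurable_funeM; apply/measurable_EFinP.
  - by move=> w _; rewrite -EFinM lee_fin !mulr_ge0.
  - exact/measurable_EFinP.
  - by move=> w _; rewrite lee_fin sqr_ge0.
  have -> : (m ^+ 2)%:E = (\int[Pr]_w (m ^+ 2)%:E)%E.
    rewrite integral_cst// -[LHS]mule1; congr (_ * _)%E.
    exact/esym/probability_setT.
  rewrite -ge0_integralD//; first last.
  - by move=> w _; rewrite lee_fin sqr_ge0.
  - apply: measurable_funeM; apply/measurable_EFinP; exact: measurable_funX.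
  - by move=> w _; rewrite -EFinM lee_fin mulr_ge0// sqr_ge0.
  apply: eq_integral => w _; rewrite /D -!EFinM -!EFinD; congr (_%:E).
  by rewrite sqrrB exprMn; ring.
have qk : q * k.+1%:R = 1 by rewrite mulVf// pnatr_eq0.
rewrite -[X in (X <= _)%E]/(\int[Pr]_w (D w)%:E)%E.
rewrite -(@leeD2rE _ (2 * m ^+ 2)%:E)//.
have -> : ((2 * m ^+ 2)%:E = (2 * m * q)%:E * \int[Pr]_w (S w)%:E)%E.
  rewrite ES -EFinM; congr (_%:E).
  rewrite (_ : 2 * m * q * (k.+1%:R * m) = 2 * m ^+ 2 * (q * k.+1%:R)); last by ring.
  by rewrite qk mulr1.
rewrite key ES.
apply: (@le_trans _ _ ((q ^+ 2)%:E *
    ((k.+1%:R ^+ 2 * m ^+ 2)%:E + k.+1%:R%:E * M2) + (m ^+ 2)%:E)%E).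
  by rewrite leeD2r// lee_wpmul2l// lee_fin sqr_ge0.
rewrite ge0_muleDr//; last 2 first.
- by rewrite lee_fin mulr_ge0// sqr_ge0.
- by rewrite mule_ge0.
rewrite -EFinM muleA -EFinM.
rewrite (_ : q ^+ 2 * (k.+1%:R ^+ 2 * m ^+ 2) = m ^+ 2); last first.
  rewrite (_ : q ^+ 2 * (k.+1%:R ^+ 2 * m ^+ 2) = (q * k.+1%:R) ^+ 2 * m ^+ 2); last by ring.
  by rewrite qk expr1n mul1r.
rewrite (_ : q ^+ 2 * k.+1%:R = q); last by rewrite expr2 -(mulrA q q) qk mulr1.
rewrite addeC addeA -EFinD addeC -EFinM.
rewrite (_ : 2 * m * q * (k.+1%:R * m) = m ^+ 2 + m ^+ 2)//.
rewrite (_ : 2 * m * q * (k.+1%:R * m) = 2 * m ^+ 2 * (q * k.+1%:R)); last by ring.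
by rewrite qk mulr1; ring.
Qed.

(** Lengths of order a ^+ n; the successor makes them positive and larger than
a ^+ n. *)
Definition geom_block (R : realType) (a : R) (n : nat) : nat :=
  (Num.truncn (a ^+ n)).+1.

Section geom_block.
Context (R : realType) (a : R) (a1 : 1 < a).
Local Notation k := (geom_block a).

Let a0 : 0 < a. Proof. exact: lt_trans a1. Qed.
Let an0 n : 0 < a ^+ n. Proof. exact: exprn_gt0. Qed.

Lemma geom_block_gt n : a ^+ n < (k n)%:R.
Proof. exact: truncnS_gt. Qed.

Lemma geom_block_le n : (k n)%:R <= a ^+ n + 1.
Proof. by rewrite /geom_block -natr1 lerD2r truncn_le// ltW. Qed.

Lemma geom_block_le2 n : (k n)%:R <= 2 * a ^+ n.
Proof.
apply: le_trans (geom_block_le n) _.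
have : 1 <= a ^+ n by rewrite exprn_ege1// ltW.
lra.
Qed.

Lemma geom_block_gt0 n : 0 < (k n)%:R :> R.
Proof. by rewrite ltr0n. Qed.

(** With x for the value of a variable, this controls the second moments of the
truncated variables, divided by the block lengths.  The nonzero terms are those
with x <= k n, so the sum is x ^+ 2 times the tail of a geometric series whose
first term is of order 1 / x. *)
Lemma sum_inv_geom_block_le (x : R) N : 0 <= x ->
  \sum_(n < N) (if x <= (k n)%:R then x else 0) ^+ 2 / (k n)%:R <=
  2 * a / (a - 1) * x.
Proof.
move=> x0.
(* b is capped at 2 * x: it is constant while x > 2 * a ^+ n, so that the
   telescoping sum bounds the tail without locating its first index *)
pose b n := Num.min (x ^+ 2 / a ^+ n) (2 * x).
have c0 : 0 < (a - 1) / a by rewrite divr_gt0// subr_gt0.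
have decr n : x ^+ 2 / a ^+ n.+1 <= x ^+ 2 / a ^+ n.
  rewrite ler_wpM2l ?sqr_ge0// lef_pV2 ?posrE//.
  by rewrite exprS ler_peMl ?ltW.
have step n : (if x <= (k n)%:R then x else 0) ^+ 2 / (k n)%:R * ((a - 1) / a)
    <= b n - b n.+1.
  case: ifPn => [xk|_]; last first.
    rewrite expr0n/= mul0r mul0r subr_ge0 /b le_min !ge_min decr lexx orbT/=.
    by [].
  have h : x ^+ 2 / a ^+ n <= 2 * x.
    rewrite ler_pdivrMr// mulrAC expr2 ler_wpM2r//.
    exact: le_trans xk (geom_block_le2 n).
  rewrite /b !min_l//; last exact: le_trans (decr _) h.
  apply: (@le_trans _ _ (x ^+ 2 / a ^+ n * ((a - 1) / a))).
    rewrite ler_wpM2r ?(ltW c0)// ler_wpM2l ?sqr_ge0// lef_pV2 ?posrE//.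
    exact/ltW/geom_block_gt.
  rewrite [a ^+ n.+1]exprS invfM.
  have -> : (a - 1) / a = 1 - a^-1 by rewrite mulrBl divff ?gt_eqF// mul1r.
  by rewrite le_eqVlt; apply/orP; left; apply/eqP; ring.
have tele : (\sum_(n < N) (if x <= (k n)%:R then x else 0) ^+ 2 / (k n)%:R) *
    ((a - 1) / a) <= b 0%N - b N.
  elim: N => [|N IH]; first by rewrite big_ord0 mul0r subrr.
  rewrite big_ord_recr/= mulrDl.
  have := step N; lra.
have bN : 0 <= b N.
  rewrite /b le_min divr_ge0 ?sqr_ge0 ?mulr_ge0//; exact: ltW.
have b0 : b 0%N <= 2 * x by rewrite /b ge_min lexx orbT.
have -> : 2 * a / (a - 1) * x = 2 * x / ((a - 1) / a).
  by rewrite invf_div; ring.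
rewrite ler_pdivlMr//; lra.
Qed.

(** The terms that count are those with k n < x: a geometric sum is at most a
multiple of its last term, here of order x.  With x for the value of a variable,
this controls the expected number of variables that truncation affects. *)
Lemma sum_geom_block_le (x : R) N : 0 <= x ->
  \sum_(n < N) (if x <= (k n)%:R then 0 else (k n)%:R) <= 2 * a / (a - 1) * x.
Proof.
move=> x0.
(* the cap is a * x since a ^+ n < x gives a ^+ n.+1 <= a * x *)
pose c n := Num.min (a ^+ n) (a * x).
have d0 : 0 < a - 1 by rewrite subr_gt0.
have incr n : a ^+ n <= a ^+ n.+1 by rewrite exprS ler_peMl ?ltW.
have step n : (if x <= (k n)%:R then 0 else (k n)%:R) * (a - 1) <=
    2 * (c n.+1 - c n).
  case: ifPn => [_|].
    rewrite mul0r mulr_ge0// subr_ge0 /c le_min !ge_min incr lexx orbT/=.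
    by [].
  rewrite -ltNge => kx.
  have h : a ^+ n <= x by rewrite ltW// (lt_trans (geom_block_gt n)).
  have h' : a ^+ n.+1 <= a * x by rewrite exprS ler_wpM2l// ltW.
  rewrite /c !min_l//; last exact: le_trans (incr n) h'.
  apply: (@le_trans _ _ (2 * a ^+ n * (a - 1))).
    by rewrite ler_wpM2r ?(ltW d0)// geom_block_le2.
  by rewrite exprS le_eqVlt; apply/orP; left; apply/eqP; ring.
have tele : (\sum_(n < N) (if x <= (k n)%:R then 0 else (k n)%:R)) * (a - 1)
    <= 2 * (c N - c 0%N).
  elim: N => [|N IH]; first by rewrite big_ord0 mul0r subrr mulr0.
  rewrite big_ord_recr/= mulrDl.
  have := step N; move: IH.
  set t := (if _ then _ else _); set S := \sum_(_ < _) _.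
  move: (c N) (c N.+1) (c 0%N) => c1 c2 c3; lra.
have cN : c N <= a * x by rewrite /c ge_min lexx orbT.
have c0 : 0 <= c 0%N by rewrite /c le_min expr0 ler01 mulr_ge0//; exact: ltW.
have -> : 2 * a / (a - 1) * x = 2 * (a * x) / (a - 1) by ring.
rewrite ler_pdivlMr//; lra.
Qed.

End geom_block.

Lemma expr_near_ge (R : realType) (M a : R) : 1 < a ->
  \forall n \near \oo, M <= a ^+ n.
Proof.
move=> a1; have d0 : 0 < a - 1 by rewrite subr_gt0.
have bern n : n%:R * (a - 1) <= a ^+ n.
  elim: n => [|n IH]; first by rewrite mul0r.
  have an1 : 1 <= a ^+ n by rewrite exprn_ege1// ltW.
  rewrite -natr1 mulrDl mul1r exprS.
  have := ler_wpM2r (ltW d0) an1; lra.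
near=> n; apply: le_trans (bern n); rewrite -ler_pdivrMr//.
by near: n; exact: nbhs_infty_ger.
Unshelve. all: by end_near. Qed.

Lemma nneseries_EFin_le (R : realType) (u : nat -> R) (l : R) :
  (forall n, 0 <= u n) -> (forall N, \sum_(n < N) u n <= l) ->
  (\sum_(n <oo) (u n)%:E <= l%:E)%E.
Proof.
move=> u0 ul; have u0' n : (0 <= n)%N -> true -> (0 <= (u n)%:E)%E by rewrite lee_fin.
apply: (lime_le (@is_cvg_nneseries R (fun n => (u n)%:E) xpredT 0%N u0')).
by apply: nearW => N; rewrite sumEFin lee_fin big_mkord.
Qed.

Lemma sqr_cvg0 (R : realType) (u : nat -> R) :
  (fun n => u n ^+ 2) @ \oo --> 0 -> u @ \oo --> 0.
Proof.
move=> h; apply/cvgr0Pnorm_lt => e e0.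
have e20 : 0 < e ^+ 2 by rewrite exprn_gt0.
move/cvgr0Pnorm_lt : h => /(_ _ e20).
apply: filterS => n; rewrite normrX => ue.
by rewrite -(ltr_pXn2r (n := 2)) ?nnegrE// ltW.
Qed.

(** Convergence along blocks.  F n is f truncated at the block length k n; H n is
k n where the truncation acts, so that B n below counts the variables of the n-th
block that it affects.  By sum_inv_geom_block_le and sum_geom_block_le, the sums
over n of the mean square deviations and of the expectations of B n are at most
multiples of the expectation of f. *)
Lemma lln_geom_block d d' (Om : measurableType d)
    (V : measurableType d') (R : realType) (Pr : probability Om R)
    (X : nat -> {RV Pr >-> V}) (Y : {RV Pr >-> V}) (f : V -> R) (a : R) :
  pairwise_independent X -> identically_distributed X Y ->
  (forall v, 0 <= f v) ->
  (distribution Pr Y).-integrable setT (fun v => (f v)%:E) -> 1 < a ->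
  {ae Pr, forall w, (fun n => (geom_block a n)%:R^-1 *
      \sum_(i < geom_block a n) f (X i w)) @ \oo -->
    \int[distribution Pr Y]_v f v}.
Proof.
move=> ind idd f0 intf a1.
set Q := distribution Pr Y.
have mfE : measurable_fun setT (fun v => (f v)%:E) by exact: measurable_int intf.
have mf : measurable_fun setT f by apply/measurable_EFinP.
pose k n : R := (geom_block a n)%:R.
have k0 n : 0 < k n by exact: geom_block_gt0.
pose F n v := if f v <= k n then f v else 0.
pose H n v := if f v <= k n then 0 else k n.
have mF n : measurable_fun setT (F n).
  apply: measurable_fun_ifT => //.
  by apply: measurable_fun_ler.
have mH n : measurable_fun setT (H n).
  apply: measurable_fun_ifT => //.
  by apply: measurable_fun_ler.
have F0 n v : 0 <= F n v by rewrite /F; case: ifP.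
have H0 n v : 0 <= H n v by rewrite /H; case: ifP => // _; exact: ltW.
have Ff n v : F n v <= f v by rewrite /F; case: ifP.
pose C := 2 * a / (a - 1).
have C0 : 0 <= C.
  have : 0 < a - 1 by rewrite subr_gt0.
  have : 0 < a by apply: lt_trans a1.
  by move=> ? ?; rewrite divr_ge0 ?mulr_ge0// ltW.
have intC : (\int[Q]_v (C * f v)%:E < +oo)%E.
  under eq_integral do rewrite EFinM.
  rewrite ge0_integralZl//; first last.
  - by move=> v _; rewrite lee_fin.
  rewrite lte_mul_pinfty// ?lee_fin//.
  by have := integrable_lty measurableT intf.
have intF n : Q.-integrable setT (fun v => (F n v)%:E).
  apply: le_integrable intf => //; first exact/measurable_EFinP.
  by move=> v _; rewrite lee_fin !ger0_norm.
have intH n : Q.-integrable setT (fun v => (H n v)%:E).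
  apply: le_integrable intf => //; first exact/measurable_EFinP.
  move=> v _; rewrite lee_fin !ger0_norm// /H.
  by case: ifPn => //; rewrite -ltNge => /ltW.
pose h n := \int[Q]_v H n v.
have hE n : (\int[Q]_v (H n v)%:E = (h n)%:E)%E.
  rewrite /h /Rintegral fineK//; exact: integrable_fin_num.
pose m n := \int[Q]_v F n v.
have mE n : (\int[Q]_v (F n v)%:E = (m n)%:E)%E.
  rewrite /m /Rintegral fineK//; exact: integrable_fin_num.
have m_cvg : m @ \oo --> \int[Q]_v f v.
  have [] := @dominated_convergence _ _ _ Q setT measurableT
    (fun n v => (F n v)%:E) (fun v => (f v)%:E) (fun v => (f v)%:E).
  - by move=> n; apply/measurable_EFinP.
  - by [].
  - apply: aeW => v _; apply: cvg_near_cst.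
    have := expr_near_ge (f v) a1.
    apply: filterS => n an; rewrite /F ifT//.
    by apply: le_trans an _; apply/ltW/geom_block_gt.
  - exact: intf.
  - by apply: aeW => v n _; rewrite lee_fin !ger0_norm.
  move=> _ _; rewrite (_ : (\int[Q]_v _)%E = (\int[Q]_v f v)%:E).
    by move=> /fine_cvgP[_]; exact.
  rewrite /Rintegral fineK//; exact: integrable_fin_num.
have Davg : {ae Pr, forall w, (fun n => ((k n)^-1 *
    (\sum_(i < geom_block a n) F n (X i w)) - m n) ^+ 2) @ \oo --> 0}.
  apply: ae_cvg0_nneseries.
  - move=> n; apply: measurable_funX; apply: measurable_funB => //.
    apply: measurable_funM => //; apply: measurable_sum => i.
    exact: measurableT_comp.
  - by move=> n w; exact: sqr_ge0.
  apply: (@le_lt_trans _ _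
      (\sum_(n <oo) \int[Q]_v (F n v ^+ 2 / k n)%:E)%E).
    apply: lee_nneseries => n _.
      by move=> _; apply: integral_ge0 => w _; rewrite lee_fin sqr_ge0.
    apply: le_trans (mean_square_deviation_le _ ind idd _ _ (mE n)) _ => //.
    under [leRHS]eq_integral do rewrite mulrC EFinM.
    rewrite ge0_integralZl//.
    - by apply/measurable_EFinP; exact: measurable_funX.
    - by move=> v _; rewrite lee_fin sqr_ge0.
    - by rewrite lee_fin invr_ge0 ltW.
  rewrite -integral_nneseries//; last 2 first.
  - move=> n; apply/measurable_EFinP; apply: measurable_funM => //.
    exact: measurable_funX.
  - by move=> n v _; rewrite lee_fin divr_ge0// ?sqr_ge0 ?ltW.
  apply: le_lt_trans intC; apply: ge0_le_integral => //.
  - by move=> v _; apply: nneseries_ge0 => n _ _;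
      rewrite lee_fin divr_ge0// ?sqr_ge0 ?ltW.
  - apply: ge0_emeasurable_sum => [n v _ _|n _].
      by rewrite lee_fin divr_ge0// ?sqr_ge0 ?ltW.
    apply/measurable_EFinP; apply: measurable_funM => //.
    exact: measurable_funX.
  - by apply/measurable_EFinP; exact: measurable_funM.
  move=> v _; apply: nneseries_EFin_le.
    by move=> n; rewrite divr_ge0// ?sqr_ge0 ?ltW.
  move=> N; exact: sum_inv_geom_block_le.
pose B n w := \sum_(i < geom_block a n) (k n)^-1 * H n (X i w).
have Bavg : {ae Pr, forall w, (fun n => B n w) @ \oo --> 0}.
  apply: ae_cvg0_nneseries.
  - move=> n; apply: measurable_sum => i; apply: measurable_funM => //.
    exact: measurableT_comp.
  - move=> n w; apply: sumr_ge0 => i _; rewrite mulr_ge0//.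
    by rewrite invr_ge0 ltW.
  apply: (@le_lt_trans _ _ (\sum_(n <oo) \int[Q]_v (H n v)%:E)%E).
    apply: lee_nneseries => n _.
      move=> _; apply: integral_ge0 => w _; rewrite lee_fin.
      by apply: sumr_ge0 => i _; rewrite mulr_ge0// invr_ge0 ltW.
    under eq_integral do rewrite /B -sumEFin.
    rewrite ge0_integral_sum//; last 2 first.
    - move=> i; apply/measurable_EFinP; apply: measurable_funM => //.
      exact: measurableT_comp.
    - by move=> i w _; rewrite lee_fin mulr_ge0// invr_ge0 ltW.
    rewrite (eq_bigr (fun=> ((k n)^-1 * h n)%:E)) => [|i _].
      rewrite sumEFin sumr_const card_ord -mulr_natl mulrA divff ?mul1r ?hE//.
      by rewrite gt_eqF.
    under eq_integral do rewrite EFinM.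
    rewrite ge0_integralZl//; last 3 first.
    - by apply/measurable_EFinP; exact: measurableT_comp.
    - by move=> v _; rewrite lee_fin.
    - by rewrite lee_fin invr_ge0 ltW.
    rewrite (@ge0_integral_identically_distributed _ _ _ _ _ _ X Y
      (fun v => (H n v)%:E))//; first by rewrite hE.
      exact/measurable_EFinP.
    by move=> v; rewrite lee_fin.
  rewrite -integral_nneseries//; last 2 first.
  - by move=> n; apply/measurable_EFinP.
  - by move=> n v _; rewrite lee_fin.
  apply: le_lt_trans intC; apply: ge0_le_integral => //.
  - by move=> v _; apply: nneseries_ge0 => n _ _; rewrite lee_fin.
  - apply: ge0_emeasurable_sum => [n v _ _|n _]; first by rewrite lee_fin.
    exact/measurable_EFinP.
  - by apply/measurable_EFinP; exact: measurable_funM.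
  move=> v _; apply: nneseries_EFin_le => // N; exact: sum_geom_block_le.
move: Davg Bavg; apply: filterS2 => w /sqr_cvg0 hD hB.
have hDm : (fun n => (k n)^-1 * (\sum_(i < geom_block a n) F n (X i w))) @ \oo
    --> \int[Q]_v f v.
  rewrite -[X in _ --> X]add0r; apply: near_cvg_seq (cvgD hD m_cvg).
  by apply: nearW => n /=; rewrite fctE subrK.
apply: near_cvg_seq hDm.
(* B n w is a natural number: as soon as it is below 1, it vanishes, and the
   truncated sum is the sum itself *)
move/cvgr0Pnorm_lt : hB => /(_ _ ltr01).
apply: filterS => n Bn1; congr (_ * _); apply: eq_bigr => i _.
rewrite /F; case: ifPn => // fk; exfalso; move: Bn1; apply/negP; rewrite -leNgt.
have term (j : 'I_(geom_block a n)) : 0 <= (k n)^-1 * H n (X j w).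
  by rewrite mulr_ge0// invr_ge0 ltW.
rewrite ger0_norm; last exact: sumr_ge0.
rewrite /B (bigD1 i)//= {1}/H (negbTE fk) mulVf ?gt_eqF// lerDl.
exact: sumr_ge0.
Qed.

(** The sums of a nonnegative sequence are monotone, so that the mean up to N, with
N between two consecutive block lengths, lies between the two block means up to a
factor, the ratio of the lengths.  For a = 1 + E this ratio is eventually at most
1 + 2 * E. *)
Lemma cvg_mean_geom_block (R : realType) (x : nat -> R) (m : R) :
  (forall i, 0 <= x i) ->
  (forall j, (fun n => (geom_block (1 + j.+1%:R^-1 : R) n)%:R^-1 *
      \sum_(i < geom_block (1 + j.+1%:R^-1 : R) n) x i) @ \oo --> m) ->
  (fun N => N%:R^-1 * \sum_(i < N) x i) @ \oo --> m.
Proof.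
move=> x0 hx.
pose S N := \sum_(i < N) x i.
have S0 N : 0 <= S N by apply: sumr_ge0.
have S_mono : {homo S : p q / (p <= q)%N >-> p <= q}.
  apply: (homo_leq (@lexx _ _) (@le_trans _ _)) => p.
  by rewrite /S big_ord_recr/= lerDl.
have m0 : 0 <= m.
  have h := hx 0%N; rewrite -(cvg_lim _ h)//; apply: limr_ge; first exact/cvgP/h.
  by apply: nearW => n; rewrite mulr_ge0// S0.
apply/cvgrPdist_le => e e0.
(* the final error is at most E * (1 + 2 * m + 2 * E), where E <= 1 *)
have [j [ee e1 ej]] : exists j, let E := j.+1%:R^-1 : R in
    [/\ 0 < E, E <= 1 & E * (3 + 2 * m) <= e].
  have d0 : 0 < e / (3 + 2 * m) by rewrite divr_gt0//; lra.
  have [j _ /(_ j (leqnn j)) hj] := near_infty_natSinv_lt (PosNum d0).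
  exists j; split => /=; [by rewrite invr_gt0| |].
    by rewrite invf_le1// ler1n.
  by rewrite -ler_pdivlMr; [exact: ltW|lra].
set E := j.+1%:R^-1 in ee e1 ej.
pose a := 1 + E; pose k n := geom_block a n.
have a1 : 1 < a by rewrite ltrDl.
have k0 n : 0 < (k n)%:R :> R by exact: geom_block_gt0.
have k_mono : {homo k : p q / (p <= q)%N}.
  move=> p q pq; rewrite /k /geom_block ltnS; apply: le_truncn.
  by apply: ler_weXn2l => //; exact: ltW.
have [n0 _ hn0] : \forall n \near \oo,
    `|m - (k n)%:R^-1 * S (k n)| <= E /\ E^-1 <= a ^+ n.
  near=> n; split; near: n; last exact: expr_near_ge.
  by move/cvgrPdist_le : (hx j) => /(_ _ ee).
exists (k n0) => // N /= n0N.
have [n [n0n knN Nkn]] : exists n, [/\ (n0 <= n)%N, (k n <= N)%N & (N < k n.+1)%N].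
  have exk : exists p, (N < k p)%N.
    have [p _ /(_ p (leqnn p)) hp] := expr_near_ge N%:R a1.
    by exists p; rewrite -(ltr_nat R); apply: le_lt_trans hp (geom_block_gt _ _).
  case: (ex_minnP exk) => -[|n] Np minp.
    move: Np; rewrite ltnNge => /negP[]; apply: leq_trans n0N.
    exact: k_mono.
  exists n; split => //.
    rewrite leqNgt; apply/negP => nn0; move: Np; rewrite ltnNge => /negP; apply.
    by apply: leq_trans n0N; exact: k_mono.
  by rewrite leqNgt; apply/negP => /minp; rewrite ltnn.
have N0 : 0 < N%:R :> R by apply: lt_le_trans (k0 n) _; rewrite ler_nat.
have ratio : (k n.+1)%:R <= (1 + 2 * E) * (k n)%:R.
  have [_ En] := hn0 n n0n.
  have h1 := geom_block_le a1 n.+1.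
  have h2 := geom_block_gt a n.
  have : 1 <= E * a ^+ n by rewrite -ler_pdivrMl// mulr1.
  have : (1 + 2 * E) * a ^+ n <= (1 + 2 * E) * (k n)%:R.
    by rewrite ler_wpM2l; [|lra|exact: ltW].
  rewrite -/(k n.+1) in h1; rewrite exprS {1}/a in h1.
  move: h1; lra.
have [+ _] := hn0 n n0n; rewrite ler_distlC => /andP[lo _].
have [+ _] := hn0 n.+1 (leqW n0n); rewrite ler_distlC => /andP[_ up].
have lo' : (m - E) * (k n)%:R <= S N.
  apply: le_trans (S_mono _ _ knN).
  by move: lo; rewrite mulrC ler_pdivlMr.
have up' : S N <= (m + E) * (k n.+1)%:R.
  apply: le_trans (S_mono _ _ (ltnW Nkn)) _.
  by move: up; rewrite mulrC ler_pdivrMr.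
have kN : (k n)%:R <= N%:R :> R by rewrite ler_nat.
have Nk : N%:R <= (k n.+1)%:R :> R by rewrite ler_nat ltnW.
rewrite -/(S N) ler_distlC; apply/andP; split.
  rewrite mulrC ler_pdivlMr//.
  have [mE|Em] := leP m E.
    apply: le_trans (S0 N); rewrite mulr_le0_ge0 ?(ltW N0)//.
    have : 0 <= E * m by rewrite mulr_ge0// ltW.
    lra.
  apply: le_trans lo'.
  have h : (1 - 2 * E) * N%:R <= (k n)%:R.
    have [E2|E2] := leP (1 - 2 * E) 0.
      apply: (@le_trans _ _ 0); last exact: ltW.
      by rewrite mulr_le0_ge0// ltW.
    apply: (@le_trans _ _ ((1 - 2 * E) * ((1 + 2 * E) * (k n)%:R))).
      by rewrite ler_wpM2l ?(ltW E2)//; exact: le_trans ratio.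
    have : 0 <= E ^+ 2 * (k n)%:R by rewrite mulr_ge0 ?sqr_ge0// ltW.
    lra.
  apply: (@le_trans _ _ ((m - E) * ((1 - 2 * E) * N%:R))); last first.
    by rewrite ler_wpM2l//; lra.
  rewrite mulrA ler_wpM2r ?(ltW N0)//.
  have : 0 <= E ^+ 2 by exact: sqr_ge0.
  have : 0 <= E * m by rewrite mulr_ge0// ltW.
  lra.
rewrite mulrC ler_pdivrMr//.
apply: le_trans up' _.
apply: (@le_trans _ _ ((m + E) * ((1 + 2 * E) * N%:R))).
  rewrite ler_wpM2l//; first lra.
  apply: le_trans ratio _; rewrite ler_wpM2l//; lra.
rewrite mulrA ler_wpM2r ?(ltW N0)//.
have : E ^+ 2 <= E by rewrite expr2 ler_piMl// ltW.
lra.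
Unshelve. all: by end_near. Qed.

Lemma ge0_strong_law d d' (Om : measurableType d)
    (V : measurableType d') (R : realType) (Pr : probability Om R)
    (X : nat -> {RV Pr >-> V}) (Y : {RV Pr >-> V}) (f : V -> R) :
  pairwise_independent X -> identically_distributed X Y ->
  (forall v, 0 <= f v) ->
  (distribution Pr Y).-integrable setT (fun v => (f v)%:E) ->
  {ae Pr, forall w, (fun N => N%:R^-1 * \sum_(i < N) f (X i w)) @ \oo -->
    \int[distribution Pr Y]_v f v}.
Proof.
move=> ind idd f0 intf.
have : {ae Pr, forall w j, (fun n => (geom_block (1 + j.+1%:R^-1 : R) n)%:R^-1 *
      \sum_(i < geom_block (1 + j.+1%:R^-1 : R) n) f (X i w)) @ \oo -->
      \int[distribution Pr Y]_v f v}.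
  apply: ae_foralln => j; apply: lln_geom_block => //.
  by rewrite ltrDl invr_gt0.
by apply: filterS => w h; apply: (@cvg_mean_geom_block R (fun i => f (X i w))).
Qed.

Lemma strong_law d d' (Om : measurableType d)
    (V : measurableType d') (R : realType) (Pr : probability Om R)
    (X : nat -> {RV Pr >-> V}) (Y : {RV Pr >-> V}) (f : V -> R) :
  pairwise_independent X -> identically_distributed X Y ->
  (distribution Pr Y).-integrable setT (fun v => (f v)%:E) ->
  {ae Pr, forall w, (fun N => N%:R^-1 * \sum_(i < N) f (X i w)) @ \oo -->
    \int[distribution Pr Y]_v f v}.
Proof.
move=> ind idd intf.
have intp := integrable_funrpos measurableT intf.
have intn := integrable_funrneg measurableT intf.
have := @ge0_strong_law _ _ _ _ _ _ X Y _ ind idd (funrpos_ge0 f) intp.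
have := @ge0_strong_law _ _ _ _ _ _ X Y _ ind idd (funrneg_ge0 f) intn.
apply: filterS2 => w hn hp.
have -> : \int[distribution Pr Y]_v f v = \int[distribution Pr Y]_v (f^\+ v)%R -
    \int[distribution Pr Y]_v (f^\- v)%R.
  rewrite -RintegralB//; apply: eq_Rintegral => v _.
  by rewrite -[in LHS](funrposBneg f).
apply: near_cvg_seq (cvgB hp hn); apply: nearW => N /=.
rewrite fctE -mulrBr -sumrB; congr (_ * _); apply: eq_bigr => i _.
by rewrite -[in RHS](funrposBneg f).
Qed.

(** * Passing to the completed law *)

Lemma negligible_bigcup_countable d (T : measurableType d) (R : realFieldType)
    (mu : {measure set T -> \bar R}) (I : countType) (F : I -> set T) :
  (forall i, mu.-negligible (F i)) -> mu.-negligible (\bigcup_i F i).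
Proof.
move=> F0.
have -> : \bigcup_i F i =
    \bigcup_(k : nat) (if @choice.unpickle I k is Some i then F i else set0).
  apply/seteqP; split=> [x [i _ Fx]|x [k _]].
    by exists (choice.pickle i) => //; rewrite choice.pickleK.
  by case: (@choice.unpickle I k) => [i|//] Fx; exists i.
apply: negligible_bigcup => k.
by case: (@choice.unpickle I k) => [i|]; [exact: F0|exact: negligible_set0].
Qed.

Lemma ae_eq_integrable_Rintegral d (T : measurableType d) (R : realType)
    (mu : {measure set T -> \bar R}) (f g : T -> R) :
  mu.-integrable setT (fun x => (f x)%:E) -> measurable_fun setT g ->
  {ae mu, forall x, f x = g x} ->
  mu.-integrable setT (fun x => (g x)%:E) /\ \int[mu]_x f x = \int[mu]_x g x.
Proof.
move=> intf mg fg.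
have mfE := measurable_int _ intf.
have mgE : measurable_fun setT (fun x => (g x)%:E) by apply/measurable_EFinP.
split; last first.
  by congr fine; apply: ae_eq_integral => //; apply: filterS fg => x ->.
apply/integrableP; split => //; move/integrableP : intf => [_].
rewrite (ae_eq_integral (fun x => `|(g x)%:E|%E))//.
- exact: measurableT_comp.
- exact: measurableT_comp.
- by apply: filterS fg => x ->.
Qed.

(** This brings a property that holds almost surely under the completion back to
the original sigma-field, the one for which the sample is measurable. *)
Lemma ae_completed_law d d' (Om : measurableType d) (V : measurableType d')
    (R : realType) (Pr : probability Om R) (Y : {RV Pr >-> V}) (Q : V -> Prop) :
  {ae completed_law Pr Y, forall x, Q x} ->
  exists B : set V, [/\ measurable B, distribution Pr Y B = 0%E
    & forall x, ~ B x -> Q x].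
Proof.
move=> [N [mN N0 QN]].
have [B mB [NB B0]] := completed_law_hull Y N.
exists B; split => //; first by rewrite B0.
by move=> x; apply: contra_notP => nQ; apply/NB/QN.
Qed.

Lemma ae_sample d d' (Om : measurableType d) (V : measurableType d')
    (R : realType) (Pr : probability Om R) (X : nat -> {RV Pr >-> V})
    (Y : {RV Pr >-> V}) (Q : V -> Prop) :
  identically_distributed X Y ->
  {ae completed_law Pr Y, forall x, Q x} ->
  {ae Pr, forall w j, Q (X j w)}.
Proof.
move=> idd /ae_completed_law[B [mB B0 BQ]].
apply: ae_foralln => j; exists (X j @^-1` B); split.
- by rewrite -[X in measurable X]setTI; exact: measurable_funPT.
- have : distribution Pr (X j) B = 0%E by rewrite idd.
  by [].
- by move=> w /= nQ; apply: contrapT => /BQ.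
Qed.

(** Each set where f is below a given rational differs from a measurable set by a
null set.  Off the union of these countably many null sets, f is measurable with
respect to the original sigma-field; g is f made 0 on this union. *)
Lemma completed_law_borel_version d d' (Om : measurableType d)
    (V : measurableType d') (R : realType) (Pr : probability Om R)
    (Y : {RV Pr >-> V}) (f : V -> R) :
  measurable_fun setT (f : completed Pr Y -> R) ->
  exists g : V -> R, exists B : set V, [/\ measurable_fun setT g, measurable B,
    distribution Pr Y B = 0%E & forall x, ~ B x -> f x = g x].
Proof.
move=> mf.
have dec (q : rat) : exists AC : set V * set V,
    [/\ measurable AC.1, measurable AC.2, distribution Pr Y AC.2 = 0%E
      & forall x, ~ AC.2 x -> (f x < ratr q <-> AC.1 x)].
  have : ((distribution Pr Y)^*)%mu.-cara.-measurable
      (setT `&` f @^-1` `]-oo, ratr q[).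
    exact: mf.
  rewrite completed_law_measurable => -[A mA [N [C [mC C0 NC]] AN]].
  exists (A, C); split => //= x nCx.
  have : (A `|` N) x <-> f x < ratr q.
    by rewrite AN/= in_itv/=; split => [[]|].
  move=> <-; split => [[//|Nx]|]; last by left.
  by exfalso; apply: nCx; exact: NC.
have [AC ACP] := choice dec.
pose B := \bigcup_q (AC q).2.
have mB : measurable B by apply: bigcupT_measurable_rat => q; case: (ACP q).
have B0 : distribution Pr Y B = 0%E.
  apply/negligibleP => //; apply: negligible_bigcup_countable => q.
  by apply/negligibleP; case: (ACP q).
exists (fun x => if x \in B then 0 else f x), B; split => //; last first.
  by move=> x nBx; rewrite memNset.
apply: (measurability _ (RGenInftyO.measurableE R)) => // _ [_ [y ->] <-].
rewrite setTI.
have -> : (fun x => if x \in B then 0 else f x) @^-1` `]-oo, y[ =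
    (B `&` [set x | 0 < y]) `|`
    (~` B `&` \bigcup_(q : rat) (if ratr q < y then (AC q).1 else set0)).
  apply/seteqP; split=> [x|x] /=; rewrite in_itv/=.
    have [/set_mem Bx y0|/negP nBx fy] := boolP (x \in B); first by left.
    have nBx' : ~ B x by move=> ?; apply: nBx; exact: mem_set.
    right; split => //.
    have [q] := rat_in_itvoo fy; rewrite in_itv/= => /andP[fq qy].
    exists q => //; rewrite qy.
    have [_ _ _ h] := ACP q; apply/h => // Cx; apply: nBx'.
    by exists q.
  case=> [[Bx y0]|[nBx [q _]]]; first by rewrite mem_set.
  rewrite memNset//.
  case: ifPn => // qy Ax; apply: lt_trans qy.
  have [_ _ _ h] := ACP q; apply/h => // Cx; apply: nBx.
  by exists q.
apply: measurableU.
  have [y0|y0] := pselect (0 < y).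
    by rewrite (_ : [set _ | _] = setT) ?setIT//; apply/seteqP; split.
  by rewrite (_ : [set _ | _] = set0) ?setI0//; apply/seteqP; split.
apply: measurableI; first exact: measurableC.
apply: bigcupT_measurable_rat => q; case: ifP => // _; by case: (ACP q).
Qed.

Lemma measurable_id_completed d d' (Om : measurableType d)
    (V : measurableType d') (R : realType) (Pr : probability Om R)
    (Y : {RV Pr >-> V}) :
  measurable_fun setT (id : completed Pr Y -> V).
Proof.
move=> _ B mB; rewrite setTI.
exact: (@caratheodory_measurable_mu_ext _ _ _ (distribution Pr Y)).
Qed.

(** The law is the image of its completion under the identity map. *)
Lemma completed_law_borel_integrable d d' (Om : measurableType d)
    (V : measurableType d') (R : realType) (Pr : probability Om R)
    (Y : {RV Pr >-> V}) (g : V -> R) : measurable_fun setT g ->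
  (completed_law Pr Y).-integrable setT (fun x => (g x)%:E) ->
  (distribution Pr Y).-integrable setT (fun x => (g x)%:E) /\
  \int[completed_law Pr Y]_x g x = \int[distribution Pr Y]_x g x.
Proof.
move=> mg intg.
have mgE : measurable_fun setT (fun x : V => (g x)%:E) by apply/measurable_EFinP.
have mid := @measurable_id_completed _ _ _ _ _ _ Y.
have E (H : V -> \bar R) : (\int[distribution Pr Y]_x H x =
    \int[pushforward (completed_law Pr Y) (id : completed Pr Y -> V)]_x H x)%E.
  apply: eq_measure_integral => B mB _.
  by rewrite /pushforward; apply/esym/completed_lawE.
split.
  apply/integrableP; split => //; rewrite E.
  have := integrable_pushforward mid mgE intg measurableT.
  by move=> /integrableP[].
congr fine; rewrite E.
by rewrite (integral_pushforward mid mgE intg).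
Qed.

Lemma strong_law_completed d d' (Om : measurableType d)
    (V : measurableType d') (R : realType) (Pr : probability Om R)
    (X : nat -> {RV Pr >-> V}) (Y : {RV Pr >-> V}) (f : V -> R) :
  mutually_independent X -> identically_distributed X Y ->
  (completed_law Pr Y).-integrable setT (fun v => (f v)%:E) ->
  {ae Pr, forall w, (fun N => N%:R^-1 * \sum_(i < N) f (X i w)) @ \oo -->
    \int[completed_law Pr Y]_v f v}.
Proof.
move=> ind idd intf.
have mf : measurable_fun setT (f : completed Pr Y -> R).
  by apply/measurable_EFinP; exact: measurable_int intf.
have [g [B [mg mB B0 fg]]] := completed_law_borel_version mf.
have mgc : measurable_fun setT (g : completed Pr Y -> R).
  exact: (measurableT_comp mg (@measurable_id_completed _ _ _ _ _ _ Y)).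
have aefg : {ae completed_law Pr Y, forall v, f v = g v}.
  exists B; split.
  - exact: (@caratheodory_measurable_mu_ext _ _ _ (distribution Pr Y)).
  - by rewrite completed_lawE.
  - by move=> x /= fgx; apply: contrapT => /fg.
have [intg fgE] := ae_eq_integrable_Rintegral intf mgc aefg.
have [intgd gE] := completed_law_borel_integrable mg intg.
have -> : \int[completed_law Pr Y]_v f v = \int[distribution Pr Y]_v g v.
  by rewrite -gE -fgE.
have := strong_law (mutually_pairwise_independent ind) idd intgd.
apply: filterS2 (ae_sample idd aefg) => w h.
apply: near_cvg_seq; apply: nearW => N; congr (_ * _).
by apply: eq_bigr => i _; rewrite h.
Qed.

(** * The strong law at moving points *)

(** Everything that the uniform law uses about a sample, stated for a measure P that
may live on a larger sigma-field than the one for which the X j are measurable. *)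
Definition obeys_strong_law d d' (Om : measurableType d) (V : measurableType d')
    (R : realType) (Pr : {measure set Om -> \bar R})
    (P : {measure set V -> \bar R}) (X : nat -> Om -> V) : Prop :=
  (forall Q : V -> Prop,
    {ae P, forall x, Q x} -> {ae Pr, forall w j, Q (X j w)}) /\
  (forall f : V -> R, P.-integrable setT (fun x => (f x)%:E) ->
    {ae Pr, forall w, (fun N => N%:R^-1 * \sum_(i < N) f (X i w)) @ \oo -->
      \int[P]_x f x}).

Section oscillation.
Context (R : realType) (E : normedModType R) (V : Type).
Variables (e : nat -> E) (F : V -> E -> R).

(** The supremum is over a sequence so as to be measurable in x; when the sequence is
dense in C, continuity makes it the supremum over C (le_oscillation). *)
Definition oscillation (p : E) (r : R) (x : V) : \bar R :=
  esups (fun j => (if `[<ball p r (e j)>] then `|F x (e j) - F x p| else 0)%:E) 0.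

Lemma oscillation_le p r x (M : R) : 0 <= M ->
  (forall j, ball p r (e j) -> `|F x (e j) - F x p| <= M) ->
  (oscillation p r x <= M%:E)%E.
Proof.
move=> M0 h; apply: ub_ereal_sup => _ [j _ <-]; rewrite lee_fin.
by case: asboolP => // /h.
Qed.

Lemma oscillation_ge0 p r x : (0 <= oscillation p r x)%E.
Proof.
apply: (@le_trans _ _
    (if `[<ball p r (e 0%N)>] then `|F x (e 0%N) - F x p| else 0)%:E).
  by rewrite lee_fin; case: ifP.
by apply: ereal_sup_ubound; exists 0%N.
Qed.

Lemma le_oscillation_dense p r x j : ball p r (e j) ->
  (`|F x (e j) - F x p|%:E <= oscillation p r x)%E.
Proof.
move=> b; apply: (@le_trans _ _
    (if `[<ball p r (e j)>] then `|F x (e j) - F x p| else 0)%:E).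
  by rewrite asboolT.
by apply: ereal_sup_ubound; exists j.
Qed.

Variable C : set E.
Hypothesis e_dense : forall z, C z -> forall r, 0 < r -> exists j, ball z r (e j).

Lemma le_oscillation p r x z : continuous (F x) -> C z -> ball p r z ->
  (`|F x z - F x p|%:E <= oscillation p r x)%E.
Proof.
move=> cF Cz bz; apply/lee_addgt0Pr => /= t t0.
have : \forall y \near z, ball p r y /\ `|F x z - F x y| <= t.
  apply: filterI; first exact: (open_nbhs_nbhs (conj (ball_open p r) bz)).
  by move/cvgrPdist_le : (cF z); apply.
move=> /nbhs_ballP[s /= s0 hs].
have [j bj] := e_dense Cz s0.
have [bp h] := hs _ bj.
apply: (@le_trans _ _ (`|F x (e j) - F x p|%:E + t%:E)%E).
  rewrite -EFinD lee_fin.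
  rewrite (_ : F x z - F x p = (F x (e j) - F x p) + (F x z - F x (e j))); last by ring.
  by rewrite (le_trans (ler_normD _ _))// lerD2l.
by rewrite leeD2r// le_oscillation_dense.
Qed.

Lemma cvg_oscillation (r : nat -> R) p x : continuous (F x) ->
  r @ \oo --> 0 -> (fun k => oscillation p (r k) x) @ \oo --> 0%E.
Proof.
move=> cF r0.
have small t : 0 < t -> \forall k \near \oo, (oscillation p (r k) x <= t%:E)%E.
  move=> t0.
  have : \forall y \near p, `|F x p - F x y| <= t.
    by move/cvgrPdist_le : (cF p); apply.
  move=> /nbhs_ballP[s /= s0 hs].
  move/cvgrPdist_le : r0 => /(_ _ s0); apply: filterS => k rk.
  apply: oscillation_le => [|j bj]; first exact: ltW.
  rewrite distrC; apply/hs; apply: le_ball bj.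
  by move: rk; rewrite sub0r normrN; apply: le_trans; exact: ler_norm.
apply/fine_cvgP; split.
  apply: filterS (small _ ltr01) => k h.
  by rewrite ge0_fin_numE ?oscillation_ge0// (le_lt_trans h)// ltry.
apply/cvgr0Pnorm_le => t t0; apply: filterS (small _ t0) => k h /=.
rewrite ger0_norm ?fine_ge0 ?oscillation_ge0//.
rewrite -lee_fin fineK// ge0_fin_numE ?oscillation_ge0//.
by rewrite (le_lt_trans h)// ltry.
Qed.

(** Dominated convergence gives balls of small mean oscillation around any point p,
but only the countably many points of the dense sequence may serve as centres in
an almost sure statement; this compares the two. *)
Lemma oscillation_recenter p q r s x : C q -> continuous (F x) ->
  ball p r q -> ball q s `<=` ball p r ->
  (oscillation q s x <= 2%:E * oscillation p r x)%E.
Proof.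
move=> Cq cF bq sub.
have [fin|] := boolP (oscillation p r x \is a fin_num); last first.
  rewrite ge0_fin_numE ?oscillation_ge0// -leNgt leye_eq => /eqP ->.
  by rewrite gt0_muley ?leey// lte_fin.
have M0 : 0 <= fine (oscillation p r x).
  by rewrite fine_ge0// oscillation_ge0.
rewrite -(fineK fin) -EFinM.
apply: oscillation_le => [|j /sub bj]; first by rewrite mulr_ge0.
have hj := le_oscillation_dense x bj.
have hq := le_oscillation cF Cq bq.
rewrite -(fineK fin) lee_fin in hj; rewrite -(fineK fin) lee_fin in hq.
rewrite (_ : F x (e j) - F x q = (F x (e j) - F x p) - (F x q - F x p)); last by ring.
rewrite (le_trans (ler_normB _ _))// mulr_natl mulr2n; exact: lerD.
Qed.
End oscillation.

Lemma measurable_oscillation (R : realType) (E : normedModType R) d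
    (V : measurableType d) (e : nat -> E) (F : V -> E -> R) p r :
  measurable_fun setT (F ^~ p) -> (forall j, measurable_fun setT (F ^~ (e j))) ->
  measurable_fun setT (oscillation e F p r).
Proof.
move=> mp me; apply: measurable_fun_esups => j.
apply/measurable_EFinP; case: asboolP => _; last exact: measurable_cst.
by apply: measurableT_comp => //; exact: measurable_funB.
Qed.

Section uniform_law.
Context d d' (Om : measurableType d) (V : measurableType d') (R : realType).
Variables (Pr : {measure set Om -> \bar R}) (P : {measure set V -> \bar R}).
Variables (X : nat -> Om -> V) (E : normedModType R).
Variables (C : set E) (e : nat -> E) (F : V -> E -> R).
Hypothesis XP : obeys_strong_law Pr P X.
Hypothesis eC : forall j, C (e j).
Hypothesis e_dense : forall z, C z -> forall r, 0 < r -> exists j, ball z r (e j).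
Hypothesis F_cont : {ae P, forall x, continuous (F x)}.
Hypothesis F_int : forall z, C z -> P.-integrable setT (fun x => (F x z)%:E).
Hypothesis F_bound : forall z, C z -> exists rho c,
  [/\ 0 < rho, P.-integrable setT (fun x => (c x)%:E)
    & {ae P, forall x y, C y -> ball z rho y -> `|F x y| <= c x}].

Let osc := oscillation e F.

Let mF z : C z -> measurable_fun setT (F ^~ z).
Proof. by move=> Cz; apply/measurable_EFinP; exact: measurable_int (F_int Cz). Qed.

Let mosc z r : C z -> measurable_fun setT (osc z r).
Proof. by move=> Cz; apply: measurable_oscillation => *; exact: mF. Qed.

(** By dominated convergence, the mean oscillation around z tends to 0 with the
radius, and it is carried over to a nearby point of the dense sequence. *)
Lemma small_oscillation z t : C z -> 0 < t -> exists i k,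
  [/\ ball (e i) k.+1%:R^-1 z,
    P.-integrable setT (osc (e i) k.+1%:R^-1)
    & (\int[P]_x osc (e i) k.+1%:R^-1 x <= t%:E)%E].
Proof.
move=> Cz t0.
have [rho [c [rho0 intc Fc]]] := F_bound Cz.
pose r k := rho * k.+1%:R^-1.
have r0 k : 0 < r k by rewrite mulr_gt0// invr_gt0.
have rrho k : r k <= rho by rewrite ler_piMr ?(ltW rho0)// invf_le1// ler1n.
have dom : {ae P, forall x, continuous (F x) /\
    forall k, (osc z (r k) x <= (2 * c x)%:E)%E}.
  move: F_cont Fc; apply: filterS2 => x cF h; split=> // k.
  have c0 : 0 <= c x by apply: le_trans (h z Cz (ballxx _ rho0)).
  apply: oscillation_le => [|j bj]; first by rewrite mulr_ge0.
  rewrite (le_trans (ler_normB _ _))// mulr_natl mulr2n lerD//.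
    by apply: h => //; exact: le_ball bj.
  exact: h (ballxx _ rho0).
have int2c : P.-integrable setT (fun x => (2 * c x)%:E).
  by under eq_fun do rewrite EFinM; exact: integrableZl.
have rcvg : r @ \oo --> 0.
  rewrite -[X in _ --> X](mulr0 rho); apply: cvgMr.
  apply/cvgrPdist_lt => s s0; near=> k.
  rewrite sub0r normrN ger0_norm ?invr_ge0//.
  by near: k; exact: (near_infty_natSinv_lt (PosNum s0)).
have osc_cvg : {ae P, forall x, setT x -> osc z (r k) x @[k --> \oo] --> 0%E}.
  by apply: filterS dom => x [cF _] _; exact: cvg_oscillation.
have osc_dom : {ae P, forall x k, setT x ->
    (`|osc z (r k) x| <= (2 * c x)%:E)%E}.
  by apply: filterS dom => x [_ h] k _; rewrite gee0_abs ?oscillation_ge0.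
have [_ _] := dominated_convergence measurableT (fun k => mosc (r k) Cz)
  (measurable_cst _) osc_cvg int2c osc_dom.
rewrite integral0 => W0.
have [k0 _ hk0] : \forall k \near \oo, (\int[P]_x osc z (r k) x <= (t / 2)%:E)%E.
  move/fine_cvgP : W0 => [Wfin /cvgr0Pnorm_le W].
  have t20 : 0 < t / 2 by rewrite divr_gt0.
  move: Wfin (W _ t20); apply: filterS2 => k fin.
  rewrite /= ger0_norm; last first.
    by rewrite fine_ge0// integral_ge0// => x _; exact: oscillation_ge0.
  by rewrite -lee_fin fineK.
have {hk0} hk0 := hk0 k0 (leqnn k0).
set rr := r k0 in hk0.
have rr20 : 0 < rr / 2 by rewrite divr_gt0// r0.
have [k _ /(_ k (leqnn k)) hk] := near_infty_natSinv_lt (PosNum rr20).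
rewrite /= in hk.
have k0' : 0 < k.+1%:R^-1 :> R by rewrite invr_gt0.
have [i bi] := e_dense Cz k0'.
have bz : ball (e i) k.+1%:R^-1 z by exact: ball_sym.
have kr : k.+1%:R^-1 + k.+1%:R^-1 <= rr.
  by move: (k.+1%:R^-1) (rr) hk => q q'; lra.
have bi' : ball z rr (e i).
  by apply: le_ball bi; apply: le_trans kr; rewrite lerDl ltW.
have sub : ball (e i) k.+1%:R^-1 `<=` ball z rr.
  by move=> y by_; apply: le_ball (ball_triangle bi by_).
have ae_le : {ae P, forall x, setT x ->
    (osc (e i) k.+1%:R^-1 x <= 2%:E * osc z rr x)%E}.
  by apply: filterS F_cont => x cF _; exact: (oscillation_recenter e_dense).
have I0 : (\int[P]_x osc (e i) k.+1%:R^-1 x <= t%:E)%E.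
  apply: (@le_trans _ _ (\int[P]_x (2%:E * osc z rr x))%E).
    apply: ae_ge0_le_integral => //.
    - by move=> x _; exact: oscillation_ge0.
    - exact: mosc.
    - by move=> x _; rewrite mule_ge0// oscillation_ge0.
    - by apply: measurable_funeM; exact: mosc.
  rewrite ge0_integralZl//; first last.
  - by move=> x _; exact: oscillation_ge0.
  - exact: mosc.
  apply: (@le_trans _ _ (2%:E * (t / 2)%:E)%E).
    by rewrite lee_wpmul2l.
  by rewrite -EFinM lee_fin mulrC divfK.
exists i, k; split => //.
apply/integrableP; split; first exact: mosc.
under eq_integral do rewrite gee0_abs ?oscillation_ge0//.
by rewrite (le_lt_trans I0)// ltry.
Unshelve. all: by end_near. Qed.

(** Choose a ball around some e i that contains z and has mean oscillation at most
t / 4.  The mean at u N and the mean at e i differ by at most a mean of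
oscillations, eventually at most t / 2; the mean at e i is eventually t / 4 close
to its expectation; this expectation is t / 4 close to the one at z. *)
Lemma uniform_strong_law :
  {ae Pr, forall w (u : nat -> E) z, (forall k, C (u k)) -> C z ->
    u @ \oo --> z ->
    (fun N => N%:R^-1 * \sum_(i < N) F (X i w) (u N)) @ \oo -->
      \int[P]_x F x z}.
Proof.
have [Xae Xlln] := XP.
(* the strong law is for real functions, while an oscillation may be infinite;
   it is finite almost everywhere when integrable *)
pose o i k x := fine (osc (e i) k.+1%:R^-1 x).
have ointE i k : P.-integrable setT (osc (e i) k.+1%:R^-1) ->
    {ae P, forall x, (o i k x)%:E = osc (e i) k.+1%:R^-1 x}.
  move=> io; have := integrable_ae measurableT io.
  by apply: filterS => x /(_ I) fin; rewrite /o fineK.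
have oint i k : P.-integrable setT (osc (e i) k.+1%:R^-1) ->
    P.-integrable setT (fun x => (o i k x)%:E).
  move=> io; apply: le_integrable io => //.
    apply/measurable_EFinP; apply: measurableT_comp => //; exact: mosc.
  move=> x _; rewrite /o.
  have := oscillation_ge0 e F (e i) k.+1%:R^-1 x; rewrite -/osc.
  by case: (osc _ _ x) => [r _|_|_]; rewrite /= ?normr0 ?leey ?lexx.
have ae1 : {ae Pr, forall w i k, P.-integrable setT (osc (e i) k.+1%:R^-1) ->
    (fun N => N%:R^-1 * \sum_(j < N) o i k (X j w)) @ \oo --> \int[P]_x o i k x}.
  apply: ae_foralln => i; apply: ae_foralln => k.
  have [io|nio] := pselect (P.-integrable setT (osc (e i) k.+1%:R^-1)).
    by apply: filterS (Xlln _ (oint _ _ io)) => w h _.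
  by apply: aeW => w io; exfalso; exact: nio io.
have ae2 : {ae Pr, forall w i k, P.-integrable setT (osc (e i) k.+1%:R^-1) ->
    forall j, (o i k (X j w))%:E = osc (e i) k.+1%:R^-1 (X j w)}.
  apply: ae_foralln => i; apply: ae_foralln => k.
  have [io|nio] := pselect (P.-integrable setT (osc (e i) k.+1%:R^-1)).
    by apply: filterS (Xae _ (ointE _ _ io)) => w h _.
  by apply: aeW => w io; exfalso; exact: nio io.
have ae3 : {ae Pr, forall w i,
    (fun N => N%:R^-1 * \sum_(j < N) F (X j w) (e i)) @ \oo -->
    \int[P]_x F x (e i)}.
  by apply: ae_foralln => i; apply: Xlln; exact: F_int.
have ae4 := Xae _ F_cont.
apply: filterS2 (filterI ae1 ae2) (filterI ae3 ae4).
move=> w [h1 h2] [h3 h4] u z Cu Cz uz.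
apply/cvgrPdist_le => t t0.
have t40 : 0 < t / 4 by rewrite divr_gt0.
have [i [k [bz io It]]] := small_oscillation Cz t40.
have {}h1 := h1 i k io; have {}h2 := h2 i k io; have {}h3 := h3 i.
have o0 x : 0 <= o i k x by rewrite fine_ge0// oscillation_ge0.
have oI := oint _ _ io.
have ot : \int[P]_x o i k x <= t / 4.
  rewrite -lee_fin /Rintegral fineK; last exact: integrable_fin_num.
  apply: le_trans It; rewrite le_eqVlt; apply/orP; left; apply/eqP.
  apply: ae_eq_integral => //.
  - exact: measurable_int oI.
  - exact: mosc.
  - by apply: filterS (ointE _ _ io) => x ->.
have dI : `|\int[P]_x F x z - \int[P]_x F x (e i)| <= t / 4.
  have iz := F_int Cz; have ii := F_int (eC i).
  rewrite -RintegralB//.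
  have iB : P.-integrable setT (EFin \o (fun x => F x z - F x (e i))).
    exact: (integrableB measurableT iz ii).
  apply: le_trans (le_normr_Rintegral measurableT iB) _.
  apply: le_trans ot; rewrite -lee_fin /Rintegral !fineK; last 2 first.
  - exact: integrable_fin_num.
  - by apply: integrable_fin_num => //; exact: (integrable_norm iB).
  apply: ae_ge0_le_integral => //.
  - exact: measurable_int (integrable_norm iB).
  - by move=> x _; rewrite lee_fin.
  - exact: measurable_int oI.
  - move: F_cont (ointE _ _ io); apply: filterS2 => x cF -> _.
    exact: (le_oscillation e_dense).
have bu : \forall N \near \oo, ball (e i) k.+1%:R^-1 (u N).
  by apply: uz; exact: (open_nbhs_nbhs (conj (ball_open _ _) bz)).
move/cvgrPdist_le : h1 => /(_ _ t40) h1.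
move/cvgrPdist_le : h3 => /(_ _ t40) h3.
near=> N.
have bN : ball (e i) k.+1%:R^-1 (u N) by near: N.
have h1N : `|\int[P]_x o i k x - N%:R^-1 * \sum_(j < N) o i k (X j w)| <= t / 4.
  by near: N.
have h3N : `|\int[P]_x F x (e i) - N%:R^-1 * \sum_(j < N) F (X j w) (e i)|
    <= t / 4.
  by near: N.
have dN : `|N%:R^-1 * \sum_(j < N) F (X j w) (e i) -
    N%:R^-1 * \sum_(j < N) F (X j w) (u N)| <=
    N%:R^-1 * \sum_(j < N) o i k (X j w).
  rewrite -mulrBr -sumrB normrM ger0_norm ?invr_ge0// ler_wpM2l ?invr_ge0//.
  apply: le_trans (ler_norm_sum _ _ _) _; apply: ler_sum => j _.
  rewrite distrC -lee_fin h2; exact: (le_oscillation e_dense).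
move: dI h1N h3N dN; rewrite !ler_norml => /andP[? ?] /andP[? ?] /andP[? ?] /andP[? ?].
apply/andP; split; lra.
Unshelve. all: by end_near. Qed.
End uniform_law.

(** * Row vectors and lower limits *)

Lemma rV_ballP (R : realType) (n : nat) (x y : 'rV[R]_n) (r : R) : 0 < r ->
  (forall i, `|x ord0 i - y ord0 i| < r) <-> ball x r y.
Proof.
move=> r0; split=> [h|[_ h] i]; last by have := h ord0 i.
by split=> // i j; rewrite (ord1 i); exact: h.
Qed.

(** Pick a point of C in each ball with rational centre and radius k.+1^-1 that meets
C, and z0 when there is none. *)
Lemma rV_dense_sequence (R : realType) (n : nat) (C : set 'rV[R]_n) (z0 : 'rV[R]_n) :
  C z0 -> exists e : nat -> 'rV[R]_n, (forall j, C (e j)) /\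
    forall z, C z -> forall r, 0 < r -> exists j, ball z r (e j).
Proof.
move=> Cz0.
pose c (qk : 'rV[rat]_n * nat) : 'rV[R]_n := map_mx ratr qk.1.
have pick (qk : 'rV[rat]_n * nat) : exists y : 'rV[R]_n, C y /\
    ((exists z, C z /\ ball (c qk) qk.2.+1%:R^-1 z) ->
     ball (c qk) qk.2.+1%:R^-1 y).
  have [[z [Cz bz]]|no] := pselect (exists z, C z /\
      ball (c qk) qk.2.+1%:R^-1 z); first by exists z.
  by exists z0; split => // h; exfalso; exact: no.
have [y yP] := choice pick.
exists (fun j => if @choice.unpickle ('rV[rat]_n * nat)%type j is Some qk
                 then y qk else z0); split.
  by move=> j; case: (@choice.unpickle _ j) => [qk|//]; case: (yP qk).
move=> z Cz r r0.
have r20 : 0 < r / 2 by rewrite divr_gt0.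
have [k _ /(_ k (leqnn k)) hk] := near_infty_natSinv_lt (PosNum r20).
rewrite /= in hk.
have k0 : 0 < k.+1%:R^-1 :> R by rewrite invr_gt0.
have rat_near i : exists q : rat, `|ratr q - z ord0 i| < k.+1%:R^-1.
  have /rat_in_itvoo[q] : z ord0 i - k.+1%:R^-1 < z ord0 i + k.+1%:R^-1.
    by rewrite ltrD2l gtrN.
  rewrite in_itv/= => qz; by exists q; rewrite ltr_distl.
have [q qP] := choice rat_near.
pose qk := (\row_i q i : 'rV[rat]_n, k).
have bz : ball (c qk) qk.2.+1%:R^-1 z.
  by apply/rV_ballP => // i; rewrite /c !mxE.
exists (choice.pickle qk); rewrite choice.pickleK.
have [_ h] := yP qk.
have by_ : ball (c qk) qk.2.+1%:R^-1 (y qk) by apply: h; exists z.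
apply: le_ball (ball_triangle (ball_sym bz) by_).
by move: hk; rewrite /qk /=; move: (k.+1%:R^-1) => t; lra.
Qed.

Lemma ball_sub_ball2 (R : realType) (n : nat) (x : 'rV[R]_n) (rho : R) : 0 < rho ->
  ball x (rho / n.+1%:R) `<=` ball2 x rho.
Proof.
move=> rho0 y; have d0 : 0 < rho / n.+1%:R by rewrite divr_gt0.
move=> /(rV_ballP _ _ d0) h; rewrite /ball2/=.
rewrite -[leRHS](ger0_norm (ltW rho0)) -sqrtr_sqr ler_sqrt; last exact: sqr_ge0.
apply: (@le_trans _ _ (\sum_(i < n) (rho / n.+1%:R) ^+ 2)).
  apply: ler_sum => i _; rewrite -[leLHS]ger0_norm ?sqr_ge0// normrX.
  by rewrite ler_pXn2r ?nnegrE ?(ltW d0)// distrC ltW.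
rewrite sumr_const card_ord -[_ *+ n]mulr_natl exprMn mulrCA ger_pMr ?exprn_gt0//.
rewrite exprVn ler_pdivrMr ?exprn_gt0// mul1r -natrX ler_nat.
by rewrite expnS expn1 (leq_trans (leqnSn n))// leq_pmulr.
Qed.

Lemma cvg_rV (R : realType) (m : nat) (w : nat -> 'rV[R]_m) (l : 'rV[R]_m) :
  (forall i, (fun k => w k ord0 i) @ \oo --> l ord0 i) -> w @ \oo --> l.
Proof.
move=> h; apply/cvg_ballP => r r0.
have : \forall k \near \oo, forall i, `|l ord0 i - w k ord0 i| < r.
  by apply: filter_forall => i; move/cvgrPdist_lt : (h i); apply.
by apply: filterS => k hk; apply/rV_ballP.
Qed.

Lemma ler_norm_rV (R : realType) (m : nat) (v : 'rV[R]_m) i : `|v ord0 i| <= `|v|.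
Proof.
rewrite leNgt; apply/negP => lt.
have v0 : 0 < `|v ord0 i| by apply: le_lt_trans lt.
have : ball (0 : 'rV[R]_m) `|v ord0 i| v.
  by rewrite mx_norm_ball /ball_/= sub0r normrN.
by move=> /(rV_ballP _ _ v0)/(_ i); rewrite mxE sub0r normrN ltxx.
Qed.

Lemma le_limf_einf (R : realType) (F : set_system nat) (v : nat -> \bar R)
    (l : \bar R) :
  (forall r : R, (r%:E < l)%E -> F [set k | (r%:E <= v k)%E]) ->
  (l <= limf_einf v F)%E.
Proof.
move=> h; rewrite limf_einfE.
have key r : (r%:E < l)%E ->
    (r%:E <= ereal_sup [set ereal_inf (v @` V) | V in F])%E.
  move=> /h Fr; apply: (@le_trans _ _ (ereal_inf (v @` [set k | (r%:E <= v k)%E]))).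
    by apply: le_ereal_inf_tmp => _ [k /= rk <-].
  by apply: ereal_sup_ubound; exists [set k | (r%:E <= v k)%E].
rewrite leNgt; apply/negP; move: key.
case: (ereal_sup _) => [s| |] key; last 2 first.
- by rewrite ltNge leey.
- case: l key {h} => [l| |] key.
  + by have := key (l - 1); rewrite lte_fin leeNy_eq => /(_ ltac:(lra)).
  + by have := key 0 (ltry _); rewrite leeNy_eq.
  + by rewrite ltxx.
case: l key {h} => [l| |] key; rewrite ?lte_fin => sl.
- have := key ((s + l) / 2); rewrite lte_fin lee_fin => /(_ ltac:(lra)); lra.
- have := key (s + 1) (ltry _); rewrite lee_fin; lra.
- by move: sl; rewrite ltNge leNye.
Qed.

Lemma near_lt_limn_einf (R : realType) (v : nat -> \bar R) (r : \bar R) :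
  (r < limn_einf v)%E -> \forall k \near \oo, (r < v k)%E.
Proof.
rewrite limn_einf_lim => rl.
rewrite (cvg_lim _ (@cvg_einfs_sup R v))// in rl.
have [_ [k _ <-] rk] := ereal_sup_gt rl.
exists k => // j /= kj; apply: lt_le_trans rk _.
by apply: ereal_inf_lbound; exists j.
Qed.


(** * Replacing the approximate solutions by the exact ones *)

Lemma cvg_powR0 (R : realType) (k : R) (t : nat -> R) : 0 < k ->
  (forall N, 0 <= t N) -> t @ \oo --> 0 -> (fun N => t N `^ k) @ \oo --> 0.
Proof.
move=> k0 t0 tcvg; apply/cvgr0Pnorm_le => r r0.
have rk0 : 0 < r `^ k^-1 by exact: powR_gt0.
move/cvgr0Pnorm_le : tcvg => /(_ _ rk0); apply: filterS => N.
rewrite ger0_norm// ger0_norm ?powR_ge0// => h.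
apply: (@le_trans _ _ ((r `^ k^-1) `^ k)).
  by apply: ge0_ler_powR; rewrite ?nnegrE ?powR_ge0// ltW.
by rewrite -powRrM mulVf ?gt_eqF// powRr1// ltW.
Qed.

(** The bound on d is affine in a j and b j, whose means stay bounded, and the factor
delta N tends to 0. *)
Lemma cvg_mean_error (R : realType) (a b eps delta : nat -> R)
    (d : nat -> nat -> R) (la lb K M : R) :
  (fun N => N%:R^-1 * \sum_(j < N) a j) @ \oo --> la ->
  (fun N => N%:R^-1 * \sum_(j < N) b j) @ \oo --> lb ->
  (forall N, 0 <= eps N) -> eps @ \oo --> 0 -> delta @ \oo --> 0 ->
  (\forall N \near \oo, forall j,
    `|d N j| <= eps N + K * (M * a j + b j) * delta N) ->
  (fun N => N%:R^-1 * \sum_(j < N) d N j) @ \oo --> 0.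
Proof.
move=> ha hb eps0 heps hdelta hd.
pose u N := eps N + K * (M * (N%:R^-1 * \sum_(j < N) a j) +
  N%:R^-1 * \sum_(j < N) b j) * delta N.
have hu : u @ \oo --> 0.
  rewrite -[X in _ --> X](_ : 0 + K * (M * la + lb) * 0 = 0); last by ring.
  apply: cvgD => //; apply: cvgM => //; apply: cvgMr; apply: cvgD => //.
  exact: cvgMr.
apply/norm_cvg0P; apply: (squeeze_cvgr _ (cvg_cst 0) hu).
apply: filterS hd => N hN; rewrite normr_ge0/= normrM ger0_norm ?invr_ge0//.
apply: (@le_trans _ _ (N%:R^-1 * \sum_(j < N)
    (eps N + K * (M * a j + b j) * delta N))).
  rewrite ler_wpM2l ?invr_ge0//; apply: le_trans (ler_norm_sum _ _ _) _.
  exact: ler_sum.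
rewrite big_split/= mulrDr lerD//.
  rewrite sumr_const card_ord -[eps N *+ N]mulr_natl mulrA.
  have [->|N0] := eqVneq N 0%N; first by rewrite mulr0 mul0r.
  by rewrite mulVf ?mul1r// pnatr_eq0.
rewrite -mulr_suml -mulr_sumr big_split/= -mulr_sumr le_eqVlt.
by apply/orP; left; apply/eqP; ring.
Qed.

(** * Convergence of the sample means *)

Lemma completed_law_obeys_strong_law d d' (Om : measurableType d)
    (V : measurableType d') (R : realType) (Pr : probability Om R)
    (X : nat -> {RV Pr >-> V}) (Y : {RV Pr >-> V}) :
  mutually_independent X -> identically_distributed X Y ->
  obeys_strong_law Pr (completed_law Pr Y)
    (fun j w => X j w : completed Pr Y).
Proof.
move=> ind idd; split=> [Q aeQ|f intf]; first exact: ae_sample idd aeQ.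
exact: strong_law_completed ind idd intf.
Qed.

Lemma perf_strong_law (R : realType) (Z U : completeNormedModType R)
    d d' (Om : measurableType d) (V : measurableType d')
    (Pr : {measure set Om -> \bar R}) (P : {measure set V -> \bar R})
    (X : nat -> Om -> V) (A : set Z) (m : nat)
    (s : V -> Z -> U) (g : 'I_m -> U * Z -> R) (n : nat) (T : 'rV[R]_n -> Z)
    (i : 'I_m) :
  obeys_strong_law Pr P X ->
  (forall z, P.-integrable setT (fun x => (perf g s x z ord0 i)%:E)) ->
  {ae P, forall x, continuous (s x)} -> continuous (g i) -> continuous T ->
  (forall zbar : 'rV[R]_n, A (T zbar) ->
    exists (rho : R) (c : V -> R),
      [/\ 0 < rho, P.-integrable setT (fun x => (c x)%:E)
        & {ae P, forall x zn, ball2 zbar rho zn -> A (T zn) ->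
            `|perf g s x (T zn)| <= c x}]) ->
  {ae Pr, forall w (u : nat -> 'rV[R]_n) z,
    (forall k, A (T (u k))) -> A (T z) -> u @ \oo --> z ->
    (fun N => N%:R^-1 * \sum_(j < N) perf g s (X j w) (T (u N)) ord0 i) @ \oo -->
    \int[P]_x g i (s x (T z), T z)}.
Proof.
move=> XP intF sc gc Tc bound.
have [[z0 Az0]|noA] := pselect (exists z, A (T z)); last first.
  by apply: aeW => w u z _ Az; exfalso; apply: noA; exists z.
have [e [eC edense]] := @rV_dense_sequence R n (T @^-1` A) z0 Az0.
have Fc : {ae P, forall x, continuous (fun z => perf g s x (T z) ord0 i)}.
  apply: filterS sc => x sxc z.
  rewrite (_ : (fun z => _) = fun z => g i (s x (T z), T z)); last first.
    by apply/funext => y; rewrite mxE.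
  have sT : (s x \o T) y @[y --> z] --> s x (T z).
    by apply: (@continuous_comp _ _ _ T (s x)); [exact: Tc|exact: sxc].
  apply: (@continuous_comp _ _ _ (fun z => (s x (T z), T z)) (g i)).
    exact: (cvg_pair sT (Tc z)).
  exact: gc.
have Fb z : (T @^-1` A) z -> exists rho c,
    [/\ 0 < rho, P.-integrable setT (fun x => (c x)%:E)
    & {ae P, forall x y, (T @^-1` A) y -> ball z rho y ->
        `|perf g s x (T y) ord0 i| <= c x}].
  move=> Az; have [rho [c [rho0 intc cb]]] := bound _ Az.
  exists (rho / n.+1%:R), c; split=> //; first by rewrite divr_gt0.
  apply: filterS cb => x h y Ay bzy.
  apply: le_trans (ler_norm_rV _ _) (h _ _ Ay).
  exact: ball_sub_ball2 bzy.
have := @uniform_strong_law _ _ Om V R Pr P X _ (T @^-1` A) e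
  (fun x z => perf g s x (T z) ord0 i) XP eC edense Fc (fun z _ => intF (T z)) Fb.
apply: filterS => w h u z Au Az uz; have := h u z Au Az uz.
rewrite (_ : \int[P]_x perf g s x (T z) ord0 i =
  \int[P]_x g i (s x (T z), T z))//.
by apply: eq_Rintegral => x _; rewrite mxE.
Qed.

Lemma le_fine_ereal_sup (R : realType) (T : Type) (B : set T) (f : T -> R) x :
  (ereal_sup [set (f y)%:E | y in B] < +oo)%E -> B x ->
  f x <= fine (ereal_sup [set (f y)%:E | y in B]).
Proof.
move=> lty Bx.
have h : ((f x)%:E <= ereal_sup [set (f y)%:E | y in B])%E.
  by apply: ereal_sup_ubound; exists x.
rewrite -lee_fin fineK// fin_numE -ltNye -ltey lty andbT.
by apply: lt_le_trans h; exact: ltNyr.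
Qed.

(** Insert g (s_ N _, _) between the two terms: the first difference is at most
eps N, and the Holder-type bound on g turns the distance of the solutions into
a term of the form required by cvg_mean_error, with M = 2 * D ^ eta, where D and
Pi bound Delta0 and pi near z. *)
Lemma approximation_error_cvg0 (R : realType) (Z U : completeNormedModType R)
    (V : Type) (A : set Z) (s : V -> Z -> U) (s_ : nat -> V -> Z -> U)
    (g : U * Z -> R) (g_ : nat -> U * Z -> R) (n : nat) (T : 'rV[R]_n -> Z)
    (eps : nat -> R) (eta kappa : R) (lambda mu : V -> R)
    (rho : R) (pi Delta0 : 'rV[R]_n -> R) (Delta : nat -> 'rV[R]_n -> R)
    (x : nat -> V) (la lb : R) (u : nat -> 'rV[R]_n) (z : 'rV[R]_n) :
  0 < eta -> 0 < kappa -> (forall v, 0 <= lambda v /\ 0 <= mu v) ->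
  (forall N, 0 <= eps N) -> eps @ \oo --> 0 ->
  (forall N, (0 < N)%N -> forall v y, A (T y) ->
    `|g_ N (v, T y) - g (v, T y)| <= eps N) ->
  (forall y, A (T y) -> 0 < pi y /\ 0 <= Delta0 y) ->
  (forall y, A (T y) -> forall v v',
    `|g (v, T y) - g (v', T y)| <=
      pi y * (`|v| `^ eta + `|v'| `^ eta + 1) * `|v - v'| `^ kappa) ->
  (forall j y, A (T y) -> forall N, (0 < N)%N ->
    Num.max `|s (x j) (T y)| `|s_ N (x j) (T y)| <= lambda (x j) * Delta0 y /\
    `|s_ N (x j) (T y) - s (x j) (T y)| <= mu (x j) * Delta N y) ->
  0 < rho ->
  let B := ball2 z rho `&` (T @^-1` A) in
  (ereal_sup [set (pi y)%:E | y in B] < +oo)%E ->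
  (ereal_sup [set (Delta0 y)%:E | y in B] < +oo)%E ->
  ereal_sup [set (Delta N y)%:E | y in B] @[N --> \oo] --> 0%E ->
  (fun N => N%:R^-1 *
    \sum_(j < N) (lambda (x j) `^ eta * mu (x j) `^ kappa)) @ \oo --> la ->
  (fun N => N%:R^-1 * \sum_(j < N) mu (x j) `^ kappa) @ \oo --> lb ->
  (forall k, A (T (u k))) -> u @ \oo --> z ->
  (fun N => N%:R^-1 * \sum_(j < N) (g_ N (s_ N (x j) (T (u N)), T (u N)) -
      g (s (x j) (T (u N)), T (u N)))) @ \oo --> 0.
Proof.
move=> eta0 kap0 lm0 eps0 epsc gapp piD lip sb rho0 B piy D0y Dc avga avgb Au uz.
set Pi := fine (ereal_sup [set (pi y)%:E | y in B]) in piy.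
set D := fine (ereal_sup [set (Delta0 y)%:E | y in B]) in D0y.
(* the absolute value makes t N nonnegative also where nothing is known
   of the supremum *)
pose t N := `|fine (ereal_sup [set (Delta N y)%:E | y in B])|.
move/fine_cvgP : Dc => [Dfin Dc].
have tc : (fun N => t N `^ kappa) @ \oo --> 0.
  apply: cvg_powR0 => //; first by move=> N; exact: normr_ge0.
  move/cvgr0Pnorm_le : Dc => Dc.
  apply/cvgr0Pnorm_le => r r0; apply: filterS (Dc _ r0) => N.
  by rewrite /t normr_id.
have uB : \forall N \near \oo, B (u N).
  have : \forall N \near \oo, ball z (rho / n.+1%:R) (u N).
    apply: uz; apply: nbhsx_ballx; by rewrite divr_gt0.
  by apply: filterS => N bu; split; [exact: ball_sub_ball2 bu|exact: Au].
apply: (@cvg_mean_error R (fun j => lambda (x j) `^ eta * mu (x j) `^ kappa)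
  (fun j => mu (x j) `^ kappa) eps (fun N => t N `^ kappa)
  (fun N j => g_ N (s_ N (x j) (T (u N)), T (u N)) -
    g (s (x j) (T (u N)), T (u N))) la lb Pi (2 * D `^ eta) avga avgb eps0 epsc tc).
have N_gt0 : \forall N \near \oo, (0 < N)%N by exists 1%N.
near=> N => j.
have BN : B (u N) by near: N.
have DfinN : ereal_sup [set (Delta N y)%:E | y in B] \is a fin_num by near: N.
have N0 : (0 < N)%N by near: N.
have [l0 m0] := lm0 (x j).
have [pi0 d00] := piD _ (Au N).
have piPi : pi (u N) <= Pi by apply: le_fine_ereal_sup.
have dD : Delta0 (u N) <= D by apply: le_fine_ereal_sup.
have D0 : 0 <= D by apply: le_trans dD.
have dt : Delta N (u N) <= t N.
  apply: le_trans (ler_norm _); apply: le_fine_ereal_sup => //.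
  by move: DfinN; rewrite fin_numE -ltey => /andP[].
have [sm sd] := sb j _ (Au N) N N0.
move: sm; rewrite ge_max => /andP[sm1 sm2].
set y := u N in BN piPi dD dt sm1 sm2 sd pi0 d00 *.
set a := s (x j) (T y) in sm1 sd *.
set a' := s_ N (x j) (T y) in sm2 sd *.
have pow_norm (v : U) : `|v| <= lambda (x j) * Delta0 y ->
    `|v| `^ eta <= lambda (x j) `^ eta * D `^ eta.
  move=> vl; rewrite -powRM//; apply: ge0_ler_powR; rewrite ?nnegrE ?(ltW eta0)//.
    by rewrite mulr_ge0.
  by apply: le_trans vl _; rewrite ler_wpM2l.
have pow_diff : `|a' - a| `^ kappa <= mu (x j) `^ kappa * t N `^ kappa.
  rewrite -powRM// ?normr_ge0//; apply: ge0_ler_powR; rewrite ?nnegrE ?(ltW kap0)//.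
    by rewrite mulr_ge0// /t normr_ge0.
  by apply: le_trans sd _; rewrite ler_wpM2l.
rewrite (_ : g_ N (a', T y) - g (a, T y) =
  (g_ N (a', T y) - g (a', T y)) + (g (a', T y) - g (a, T y))); last by ring.
apply: le_trans (ler_normD _ _) _; apply: lerD; first exact: gapp (Au N).
apply: le_trans (lip _ (Au N) a' a) _.
rewrite -/y (_ : Pi * _ * _ = Pi * (lambda (x j) `^ eta * D `^ eta +
  lambda (x j) `^ eta * D `^ eta + 1) * (mu (x j) `^ kappa * t N `^ kappa));
  last by ring.
apply: ler_pM => //.
- by rewrite mulr_ge0 ?(ltW pi0)// !addr_ge0// powR_ge0.
- apply: ler_pM => //; first exact: ltW.
  by rewrite lerD2r lerD// pow_norm.
Unshelve. all: by end_near. Qed.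

(** * The lower limit of the objectives *)

Lemma indicatorT (R : realType) (X : Type) (A : set X) x :
  A x -> indicator R A x = 0%E.
Proof. by move=> Ax; rewrite /indicator asboolT. Qed.

Lemma objective_out (R : realType) (X : Type) (m : nat) (A : set X) (f : X -> R)
    (h : 'rV[R]_m -> \bar R) (w : X -> 'rV[R]_m) x :
  ~ A x -> objective A f h w x = +oo%E.
Proof. by move=> Ax; rewrite /objective /indicator asboolF. Qed.

(** For l = +oo, any b < a will do and c compensates; this is where l > -oo is
used. *)
Lemma lt_EFinD_split (R : realType) (r a : R) (l : \bar R) :
  (-oo < l)%E -> (r%:E < a%:E + l)%E ->
  exists b c : R, [/\ b < a, (c%:E < l)%E & r <= b + c].
Proof.
case: l => [l| |//] _.
  rewrite -EFinD lte_fin => rl.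
  exists ((r + a - l) / 2), ((r - a + l) / 2); rewrite lte_fin.
  by split; lra.
by move=> _; exists (a - 1), (r - a + 1); split; [lra|exact: ltry|lra].
Qed.

(** The hypotheses on f, h_ and W concern sequences that stay in C and converge along
all indices, so the given one is completed by its limit outside I and C: outside
C the objective is +oo, and indices outside I do not count. *)
Lemma objective_liminf (R : realType) (E : topologicalType) (m : nat)
    (C : set E) (f : E -> R) (h : 'rV[R]_m -> \bar R)
    (h_ : nat -> 'rV[R]_m -> \bar R) (W : nat -> E -> 'rV[R]_m)
    (w : E -> 'rV[R]_m) :
  closed C -> lsc_relative C f ->
  (forall (v : nat -> 'rV[R]_m) (l : 'rV[R]_m), v @ \oo --> l ->
    (h l <= limn_einf (fun N => h_ N (v N)))%E /\ (-oo < h l)%E) ->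
  (forall (u : nat -> E) z, (forall k, C (u k)) -> C z -> u @ \oo --> z ->
    (fun N => W N (u N)) @ \oo --> w z) ->
  forall (I : set nat) (u : nat -> E) (z : E), u @ within I \oo --> z ->
  (objective C f h w z <=
   limf_einf (fun N => objective C f (h_ N) (W N) (u N)) (within I \oo))%E.
Proof.
move=> Ccl flsc happ Wcvg I u z uz.
apply: le_limf_einf => r rl.
suff : \forall N \near \oo, I N ->
  (r%:E <= objective C f (h_ N) (W N) (u N))%E by [].
have uzI O : nbhs z O -> \forall N \near \oo, I N -> O (u N) by move=> /uz.
have [Cz|nCz] := pselect (C z); last first.
  have nC : nbhs z (~` C) by apply: open_nbhs_nbhs; split => //; exact: closed_openC.
  have := uzI _ nC; apply: filterS => N h1 IN.
  by rewrite objective_out ?leey//; exact: h1.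
pose v N := if `[< I N /\ C (u N) >] then u N else z.
have Cv N : C (v N) by rewrite /v; case: asboolP => [[]|].
have vz : v @ \oo --> z.
  move=> O /[dup] zO /uzI; apply: filterS => N h1.
  rewrite /= /v; case: asboolP => [[IN _]|_]; first exact: h1.
  exact: nbhs_singleton.
have [hl hNy] := happ _ _ (Wcvg _ _ Cv Cz vz).
have fl := flsc _ _ Cv Cz vz.
rewrite /objective indicatorT// in rl.
have [b [c [ba cl rbc]]] : exists b c : R,
    [/\ b < f z, (c%:E < h (w z))%E & r <= b + c].
  apply: lt_EFinD_split => //; move: rl hNy.
  by case: (h (w z)) => [l| |] //=; rewrite add0r.
have bfz : (b%:E < (f z)%:E)%E by rewrite lte_fin.
have nf := near_lt_limn_einf (lt_le_trans bfz fl).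
have nh := near_lt_limn_einf (lt_le_trans cl hl).
move: nf nh; apply: filterS2 => N fN hN IN.
have [CuN|nC] := pselect (C (u N)); last first.
  by rewrite objective_out ?leey.
have vE : v N = u N by rewrite /v asboolT.
rewrite /objective indicatorT//; rewrite vE in fN hN; rewrite lte_fin in fN.
move: hN; case: (h_ N (W N (u N))) => [l| |//] hN.
- rewrite lte_fin in hN.
  by apply: le_trans (_ : (r%:E <= (0 + f (u N) + l)%:E)%E) _ => //; rewrite lee_fin; lra.
- exact: leey.
Qed.

Theorem theorem4p9 (R : realType) (Z U Xi : completeNormedModType R)
  (sepZ : separable Z) (sepU : separable U) (hilbXi : hilbertian Xi)
  (d : measure_display) (Om : measurableType d) (Pr : probability Om R)
  (xi : {RV Pr >-> borel Xi})
  (A : set Z) (f : Z -> R) (m : nat) (h : 'rV[R]_m -> \bar R)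
  (s : Xi -> Z -> U) (g : 'I_m -> U * Z -> R)
  (G_integrable : forall (z : Z) (i : 'I_m),
    (completed_law Pr xi).-integrable setT
      (fun x => (perf g s x z ord0 i)%:E))
  (Zn : nat -> set Z) (T : forall n : nat, 'rV[R]_n -> Z)
  (T_surj : forall n : nat, (0 < n)%N -> range (T n) = Zn n)
  (h_ : nat -> 'rV[R]_m -> \bar R) (g_ : nat -> 'I_m -> U * Z -> R)
  (s_ : nat -> Xi -> Z -> U)
  (sample : nat -> {RV Pr >-> borel Xi})
  (n : nat) (n_gt0 : (0 < n)%N)
  (An_closed : closed (T n @^-1` A))
  (fn_lsc : lsc_relative (T n @^-1` A) (fun zn => f (T n zn)))
  (sample_indep : mutually_independent sample)
  (sample_ident : identically_distributed sample xi)
  (s_continuous : {ae completed_law Pr xi, forall x : Xi, continuous (s x)})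
  (g_continuous : forall i : 'I_m, continuous (g i))
  (Tn_continuous : continuous (T n))
  (G_measurable : forall zn : 'rV[R]_n,
    measurable_fun setT
      ((fun x => perf g s x (T n zn)) : completed Pr xi -> borel 'rV[R]_m))
  (local_bound : forall zbar : 'rV[R]_n, A (T n zbar) ->
    exists (rho : R) (c : Xi -> R),
      [/\ 0 < rho, forall x, 0 <= c x,
          (completed_law Pr xi).-integrable setT (fun x => (c x)%:E)
        & {ae completed_law Pr xi, forall x : Xi, forall zn : 'rV[R]_n,
            ball2 zbar rho zn -> A (T n zn) ->
            `|perf g s x (T n zn)| <= c x}])
  (g_approx : exists eps : nat -> R,
    [/\ forall nu, 0 <= eps nu, eps @ \oo --> 0
      & forall nu : nat, (0 < nu)%N ->
        forall (u : U) (z : Z) (i : 'I_m), Zn n z -> A z ->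
        `|g_ nu i (u, z) - g i (u, z)| <= eps nu])
  (s_approx : exists (eta kappa : R) (lambda mu : Xi -> R)
      (rho pi Delta0 : 'rV[R]_n -> R) (Delta : nat -> 'rV[R]_n -> R),
    [/\ 0 < eta /\ 0 < kappa,
        forall x, 0 <= lambda x /\ 0 <= mu x,
        forall zn, A (T n zn) ->
          [/\ 0 < rho zn, 0 < pi zn, 0 <= Delta0 zn
            & forall nu : nat, (0 < nu)%N -> 0 <= Delta nu zn]
      & [/\
        (completed_law Pr xi).-integrable setT
            (fun x => (lambda x `^ eta * mu x `^ kappa)%:E) /\
          (completed_law Pr xi).-integrable setT
            (fun x => (mu x `^ kappa)%:E),
        forall zn : 'rV[R]_n, A (T n zn) ->
          forall (u u' : U) (i : 'I_m),
          `|g i (u, T n zn) - g i (u', T n zn)| <=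
          pi zn * (`|u| `^ eta + `|u'| `^ eta + 1) * `|u - u'| `^ kappa,
        {ae completed_law Pr xi, forall x : Xi,
          forall zn : 'rV[R]_n, A (T n zn) -> forall nu : nat, (0 < nu)%N ->
          Num.max `|s x (T n zn)| `|s_ nu x (T n zn)| <= lambda x * Delta0 zn /\
          `|s_ nu x (T n zn) - s x (T n zn)| <= mu x * Delta nu zn}
      & forall zbar : 'rV[R]_n, A (T n zbar) ->
          let B := ball2 zbar (rho zbar) `&` (T n @^-1` A) in
          [/\ (ereal_sup [set (pi zn)%:E | zn in B] < +oo)%E,
              (ereal_sup [set (Delta0 zn)%:E | zn in B] < +oo)%E
            & ereal_sup [set (Delta nu zn)%:E | zn in B]
                @[nu --> \oo] --> 0%E]]])
  (h_approx : forall (w : nat -> 'rV[R]_m) (wbar : 'rV[R]_m),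
    w @ \oo --> wbar ->
    (h wbar <= limn_einf (fun nu => h_ nu (w nu)))%E /\ (-oo < h wbar)%E) :
  {ae Pr, forall omega : Om,
    forall (N : set nat) (zseq : nat -> 'rV[R]_n) (zbar : 'rV[R]_n),
      infinite_set N -> zseq @ within N \oo --> zbar ->
      (objective A f h (mean_perf (completed_law Pr xi) g s) (T n zbar) <=
       limf_einf (fun nu => objective (T n @^-1` A) (fun zn => f (T n zn))
           (h_ nu)
           (fun zn => sample_mean (g_ nu) (s_ nu)
                        (fun j => sample j omega) nu (T n zn))
           (zseq nu))
         (within N \oo))%E}.
Proof.
have XP := completed_law_obeys_strong_law sample_indep sample_ident.
have [eps [eps0 epsc gapp]] := g_approx.
have [eta [kappa [lambda [mu [rho [pi [Delta0 [Delta]]]]]]]] := s_approx.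
move=> [[eta0 kap0] lm0 pos [[inta intb] lip sb sup]].
have Gcvg : {ae Pr, forall w (i : 'I_m) (u : nat -> 'rV[R]_n) z,
    (forall k, A (T n (u k))) -> A (T n z) -> u @ \oo --> z ->
    (fun N => N%:R^-1 *
      \sum_(j < N) perf g s (sample j w) (T n (u N)) ord0 i) @ \oo -->
    \int[completed_law Pr xi]_x g i (s x (T n z), T n z)}.
  apply: filter_forall => i.
  apply: (perf_strong_law XP (fun z => G_integrable z i) s_continuous
    (g_continuous i) Tn_continuous).
  move=> zbar /local_bound[r [c [r0 _ intc cb]]]; exists r, c; split => //.
have [XPae XPlln] := XP.
have sb' := XPae _ sb.
have avga := XPlln _ inta.
have avgb := XPlln _ intb.
apply: filterS2 (filterI Gcvg sb') (filterI avga avgb).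
move=> w [hG hs] [ha hb] I u z Iinf uz.
have := @objective_liminf R _ m (T n @^-1` A) (fun zn => f (T n zn)) h h_
  (fun nu zn => sample_mean (g_ nu) (s_ nu) (fun j => sample j w) nu (T n zn))
  (fun zn => mean_perf (completed_law Pr xi) g s (T n zn)) An_closed fn_lsc
  h_approx _ I u z uz.
apply => v y Av Ay vy.
apply: cvg_rV => i.
have [rho0 _ _ _] := pos _ Ay.
have [suppi supD supDelta] := sup _ Ay.
have err := @approximation_error_cvg0 R Z U Xi A s s_ (g i) (fun nu => g_ nu i)
  n (T n) eps eta kappa lambda mu (rho y) pi Delta0 Delta
  (fun j => sample j w) _ _ v y eta0 kap0 lm0 eps0 epsc.
have gT N : (0 < N)%N -> forall (a : U) b, A (T n b) ->
    `|g_ N i (a, T n b) - g i (a, T n b)| <= eps N.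
  by move=> N0 a b Ab; apply: gapp => //; rewrite -T_surj//; exists b.
have posT b : A (T n b) -> 0 < pi b /\ 0 <= Delta0 b by move=> /pos[].
have {}err := err _ _ gT posT (fun b Ab a a' => lip b Ab a a' i) hs rho0 suppi supD
  supDelta ha hb Av vy.
rewrite mxE -[X in _ --> X]addr0.
apply: near_cvg_seq (cvgD (hG i v y Av Ay vy) err).
apply: nearW => N /=; rewrite fctE -mulrDr -big_split/= !mxE summxE.
  congr (_ * _); apply: eq_bigr => j _; rewrite !mxE; ring.
Qed.
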